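(* The system of equations on $T^*\mathrm{S}^{n-1}$ $$\dot q=C\left[p-\left(\frac{p\cdot Cq}{q\cdot Cq}\right)q\right],\qquad \dot p=-2H(q,p)\,q$$ (the reduced equations of motion of the $n$-dimensional Veselova top) has the invariant measure $$\sqrt{\frac{\det(C)}{q\cdot Cq}}\;\sigma,$$ where $\sigma$ is the Liouville volume form on $T^*\mathrm{S}^{n-1}$.
   Context: Let $n\ge 2$ and $\mathbb{J}=\mathrm{diag}[J_1,\dots,J_n]$ with all $J_i>0$; $\cdot$ is the Euclidean inner product. $T^*\mathrm{S}^{n-1}$ is realised as $\{(q,p)\in\mathbb{R}^n\times\mathbb{R}^n:\|q\|=1,\ q\cdot p=0\}$. Here $C=C(q)=\left(\mathbb{J}+(q\cdot\mathbb{J}q)\mathrm{Id}_n\right)^{-1}$ and $H(q,p)=\frac12\left(p\cdot Cp-\frac{(p\cdot Cq)^2}{q\cdot Cq}\right)$. The Liouville volume form is the top exterior power (up to constant factor) of the canonical symplectic form on $T^*\mathrm{S}^{n-1}$, i.e. of the restriction of $\sum_i dq^i\wedge dp_i$. *)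

(* Defs.v *)
From HB Require Import structures.
From mathcomp Require Import all_boot all_order all_algebra.
From mathcomp Require Import all_fingroup.
From mathcomp Require Import all_classical all_reals all_analysis.
Set Implicit Arguments.
Unset Strict Implicit.
Unset Printing Implicit Defensive.
Import Order.TTheory GRing.Theory Num.Theory.
Import numFieldNormedType.Exports.
Local Open Scope classical_set_scope.
Local Open Scope ring_scope.

Notation phase R n := ('cV[R]_n * 'cV[R]_n)%type.

Section Cotangent_sphere.
Context {R : realType} {n : nat}.

Definition dot (u v : 'cV[R]_n) : R := \sum_(i < n) u i 0 * v i 0.

(* The norm `|u| of the library on 'cV[R]_n is the sup norm. *)
Definition enorm (u : 'cV[R]_n) : R := Num.sqrt (dot u u).

(* T^*S^(n-1), embedded in R^n x R^n *)
Definition cotangent_sphere : set (phase R n) :=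
  [set x | enorm x.1 = 1 /\ dot x.1 x.2 = 0].

(* v is tangent to T^*S^(n-1) at x: it is in the kernel of the differentials
   at x of the defining functions q.q and q.p. *)
Definition tangent (x v : phase R n) : Prop :=
  dot x.1 v.1 = 0 /\ dot v.1 x.2 + dot x.1 v.2 = 0.

(* \sum_i dq^i /\ dp_i *)
Definition canonical_form (u v : phase R n) : R := dot u.1 v.2 - dot v.1 u.2.

End Cotangent_sphere.

Lemma double_ord_proof m (i : 'I_m) : (i.*2 < m.*2)%N.
Proof. by rewrite ltn_double. Qed.

Lemma doubleS_ord_proof m (i : 'I_m) : (i.*2.+1 < m.*2)%N.
Proof. by rewrite ltn_Sdouble. Qed.

(* The m-th exterior power of an alternating 2-form w, evaluated at the vectors
   v_0, ..., v_(2m-1):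
     (w /\ ... /\ w)(v)
       = (2!)^-m \sum_s sgn(s) \prod_(i < m) w (v_(s(2i)), v_(s(2i+1))). *)
Definition exterior_power (R : realType) (V : Type) (w : V -> V -> R) (m : nat)
    (v : 'I_(m.*2) -> V) : R :=
  (2 ^+ m)^-1 * \sum_(s : 'S_(m.*2)) (-1) ^+ s *
    \prod_(i < m) w (v (s (Ordinal (double_ord_proof i))))
                    (v (s (Ordinal (doubleS_ord_proof i)))).

Section Invariance.
Context {R : realType} {n : nat}.

(* Differential forms of degree 2(n-1) on T^*S^(n-1); only the values at points
   of T^*S^(n-1) and at vectors tangent to it are meaningful. *)
Definition top_form := phase R n -> ('I_(n.-1.*2) -> phase R n) -> R.

Definition liouville_form : top_form :=
  fun _ v => exterior_power canonical_form v.

(* Phi (t, x) is the C^1 local flow, for times a < t < b and initial conditions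
   x in the open subset U of T^*S^(n-1), of the vector field X.  As usual for
   maps defined on a submanifold, differentiability is expressed by an extension
   to an open subset of the ambient space; the flow equation is required on
   T^*S^(n-1) only. *)
Definition local_flow (X : phase R n -> phase R n) (a b : R)
    (U : set (phase R n)) (Phi : R * phase R n -> phase R n) : Prop :=
  [/\ a < 0 < b /\ open U,
      forall t x, a < t < b -> U x ->
        differentiable Phi (t, x) /\
        forall w, {for (t, x), continuous (fun z => 'd Phi z w)},
      forall x, U x -> cotangent_sphere x -> Phi (0, x) = x,
      forall t x, a < t < b -> U x -> cotangent_sphere x ->
        cotangent_sphere (Phi (t, x)) &
      forall t x, a < t < b -> U x -> cotangent_sphere x ->
        is_derive t (1 : R) (fun s : R => Phi (s, x)) (X (Phi (t, x)))].

(* Phi_t^* mu = mu for every local flow Phi_t of X on T^*S^(n-1) *)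
Definition preserved_by_flow (X : phase R n -> phase R n) (mu : top_form) :
    Prop :=
  forall a b U Phi, local_flow X a b U Phi ->
  forall t x v, a < t < b -> U x -> cotangent_sphere x ->
    (forall i, tangent x (v i)) ->
    mu (Phi (t, x)) (fun i => 'd (fun y => Phi (t, y)) x (v i)) = mu x v.

(* The measure f sigma, with sigma the Liouville volume form, is a positive
   density on T^*S^(n-1) and is preserved by the flow of X. *)
Definition invariant_measure (X : phase R n -> phase R n)
    (f : phase R n -> R) : Prop :=
  (forall x, cotangent_sphere x -> 0 < f x) /\
  preserved_by_flow X (fun x v => f x * liouville_form x v).

End Invariance.

Section Veselova.
Context {R : realType} {n : nat}.
Variable J : 'rV[R]_n.

Definition Cmx (q : 'cV[R]_n) : 'M[R]_n :=
  invmx (diag_mx J + (dot q (diag_mx J *m q))%:M).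

Definition hamiltonian (x : phase R n) : R :=
  let: (q, p) := x in
  (dot p (Cmx q *m p) - dot p (Cmx q *m q) ^+ 2 / dot q (Cmx q *m q)) / 2.

Definition veselova_field (x : phase R n) : phase R n :=
  let: (q, p) := x in
  (Cmx q *m (p - (dot p (Cmx q *m q) / dot q (Cmx q *m q)) *: q),
   (- 2 * hamiltonian x) *: q).

Definition veselova_density (x : phase R n) : R :=
  let: (q, _) := x in Num.sqrt (\det (Cmx q) / dot q (Cmx q *m q)).

End Veselova.

(* Main.v *)
From HB Require Import structures.
Require Import Defs.
From mathcomp Require Import all_boot all_order all_algebra.
From mathcomp Require Import all_fingroup.
From mathcomp Require Import all_classical all_reals all_analysis.
From mathcomp Require Import ring lra zify.
Set Implicit Arguments.
Unset Strict Implicit.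
Unset Printing Implicit Defensive.
Import Order.TTheory GRing.Theory Num.Theory.
Import numFieldNormedType.Exports.
Local Open Scope classical_set_scope.
Local Open Scope ring_scope.

(** A density rho makes rho * sigma invariant when, along the flow, rho shrinks
    exactly as fast as the volume sigma of a transported frame grows. The proof
    computes both rates.

    The growth of sigma is reduced to a determinant. At a point x = (q, p) of
    T^*S^(n-1) the vectors (q, -p) and (0, q) are, up to sign, the Hamiltonian
    vector fields of the constraints q.p and q.q/2, hence orthogonal for the
    symplectic form to all tangent vectors. Splitting off this symplectic plane
    (pfaffian_split) and using Pf(M A M^T) = det M * Pf A (pfaffian_congr) shows
    that sigma(v) is a constant times the determinant of the coordinates in
    R^n x R^n of (q, -p), (0, q) and v (liouville_form_det).

    Tangent vectors transported by the flow solve w' = dX w, where X is the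
    vector field given by the formulas of the system in the ambient space
    (slope_tangent_flow). So the logarithmic derivative of the determinant is the
    ambient trace of dX, corrected by the brackets of X with (q, -p) and (0, q).
    The corrections vanish (sum_det_set_row_field), because q.V = 0 for the
    velocity V at every point with q != 0, and because X does not change when p
    moves along q. On T^*S^(n-1) the trace equals
      p.C^2 q / (q.Cq) - m tr C   with   m = p.Cq / (q.Cq)
    (trace_d_field), and the logarithmic derivative of sqrt(det C / (q.Cq)) along
    the field is the opposite (slope_density). Hence rho * det is constant along
    the flow (density_frame_det_constant).

    The flow is only assumed C^1, so w' = dX w needs an exchange of derivatives
    in which one of the mixed derivatives is not known to exist. It is obtained
    from difference quotients that converge uniformly near the base point: the
    relation has_slope expresses such a convergence, and it is stable under
    algebraic operations, so the vector field inherits it from the flow by the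
    usual rules of calculus. *)

(** * Pairs of indices *)

Local Notation ev i := (Ordinal (double_ord_proof i)).
Local Notation od i := (Ordinal (doubleS_ord_proof i)).

Lemma big_ord_double (T : Type) (idx : T) (op : Monoid.law idx) (m : nat)
    (F : 'I_(m.*2) -> T) :
  \big[op/idx]_(k < m.*2) F k = \big[op/idx]_(i < m) op (F (ev i)) (F (od i)).
Proof.
elim: m F => [F|m IH F]; first by rewrite !big_ord0.
rewrite [RHS]big_ord_recl -Monoid.mulmA.
transitivity (op (F (ev ord0)) (op (F (od ord0))
    (\big[op/idx]_(k < m.*2) F (lift ord0 (lift ord0 k))))).
  rewrite (@big_ord_recl _ _ _ m.*2.+1) big_ord_recl.
  by congr (op (F _) (op (F _) _)); apply: val_inj.
congr (op _ (op _ _)); rewrite IH; apply: eq_bigr => i _.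
by congr (op (F _) (F _)); apply: val_inj.
Qed.

Lemma sum_perm_fix0 (V : nmodType) (n : nat) (F : 'S_n.+1 -> V) :
  \sum_(s : 'S_n.+1 | s ord0 == ord0) F s =
  \sum_(s : 'S_n) F (lift_perm ord0 ord0 s).
Proof.
rewrite (reindex (lift_perm ord0 ord0)) /=.
  by apply: eq_bigl => s; rewrite lift_perm_id eqxx.
pose u (s : 'S_n.+1) k := odflt k (unlift (s ord0) (s (lift ord0 k))).
have uK (s : 'S_n.+1) k : lift (s ord0) (u s k) = s (lift ord0 k).
  rewrite /u; have := neq_lift ord0 k.
  by rewrite -(can_eq (permK s)) => /unlift_some[] ? ? ->.
have u_inj s : injective (u s).
  by move=> k l /(congr1 (lift (s ord0))); rewrite !uK => /perm_inj /lift_inj.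
exists (fun s => perm (@u_inj s)) => [s _ | s /eqP s0].
  by apply/permP=> k; rewrite permE /u lift_perm_lift lift_perm_id liftK.
apply/permP=> k; case: (unliftP ord0 k) => [k'|] ->; rewrite ?lift_perm_id //.
by have := uK s k'; rewrite s0 lift_perm_lift permE.
Qed.

Definition half_ord (n : nat) (k : 'I_(n.*2)) : 'I_n :=
  Ordinal (etrans (ltn_half_double k n) (ltn_ord k)).

(** Phase space coordinates are ordered q_0, p_0, q_1, p_1, ..., which is the
    pairing of indices that the exterior power of a 2-form uses. *)
Definition interleave (T : Type) (n : nat) (f g : 'I_n -> T) (k : 'I_(n.*2)) : T :=
  if odd k then g (half_ord k) else f (half_ord k).

Lemma interleave_ev (T : Type) (n : nat) (f g : 'I_n -> T) i :
  interleave f g (ev i) = f i.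
Proof.
by rewrite /interleave /= odd_double; congr f; apply: val_inj; rewrite /= doubleK.
Qed.

Lemma interleave_od (T : Type) (n : nat) (f g : 'I_n -> T) i :
  interleave f g (od i) = g i.
Proof.
rewrite /interleave /= odd_double /=; congr g; apply: val_inj.
by rewrite /= uphalf_double.
Qed.

(** * Pfaffians *)

Section Pfaffian.
Variable R : comNzRingType.

(** For antisymmetric [A] this is 2^m m! times the usual Pfaffian: every perfect
    matching is counted with all its orderings. *)
Definition pfaffian (m : nat) (A : 'M[R]_(m.*2)) : R :=
  \sum_(s : 'S_(m.*2)) (-1) ^+ s * \prod_(i < m) A (s (ev i)) (s (od i)).

(** Expanding the product over the pairs gives a sum over the choices of two
    columns for each pair; for each choice the sum over permutations is the
    determinant of [M] times a selection matrix, so that [\det M] factors out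
    and what remains depends on [A] only. *)
Lemma pfaffian_congr (m : nat) (M A : 'M[R]_(m.*2)) :
  pfaffian (M *m A *m M^T) = \det M * pfaffian A.
Proof.
pose psi (phi : {ffun 'I_m -> 'I_(m.*2) * 'I_(m.*2)}) :=
  interleave (fun i => (phi i).1) (fun i => (phi i).2).
pose sel phi : 'M[R]_(m.*2) := \matrix_(k, c) (c == psi phi k)%:R.
suff expand (N : 'M[R]_(m.*2)) : pfaffian (N *m A *m N^T) =
    \det N *
    \sum_(phi : {ffun 'I_m -> 'I_(m.*2) * 'I_(m.*2)})
      (\prod_i A (phi i).1 (phi i).2 * \det (sel phi)).
  by rewrite expand -[A in RHS]mulmx1 -trmx1 -[A in RHS]mul1mx expand det1 mul1r.
have entry k l : (N *m A *m N^T) k l =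
    \sum_(ab : 'I_(m.*2) * 'I_(m.*2)) A ab.1 ab.2 * (N k ab.1 * N l ab.2).
  rewrite -(pair_bigA _ (fun a b => A a b * (N k a * N l b))) /= exchange_big mxE.
  apply: eq_bigr => b _; rewrite !mxE mulr_suml; apply: eq_bigr => a _; ring.
rewrite /pfaffian.
under eq_bigr => s _.
  under eq_bigr => i _ do rewrite entry.
  rewrite bigA_distr_bigA mulr_sumr.
  under eq_bigr => phi _ do rewrite big_split mulrCA.
  over.
rewrite exchange_big mulr_sumr; apply: eq_bigr => phi _.
rewrite -mulr_sumr mulrCA; congr (_ * _).
rewrite -(det_tr N) mulrC -det_mulmx; apply: eq_bigr => s _; congr (_ * _).
transitivity (\prod_(k < m.*2) N (s k) (psi phi k)).
  rewrite big_ord_double; apply: eq_bigr => i _.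
  by rewrite /psi interleave_ev interleave_od.
apply: eq_bigr => k _; rewrite mxE (bigD1 (psi phi k)) //= !mxE eqxx mul1r.
by rewrite big1 ?addr0 // => c; rewrite !mxE => /negPf ->; rewrite mul0r.
Qed.

Let lift2 m (k : 'I_(m.*2)) : 'I_(m.+1.*2) := lift ord0 (lift ord0 k).

(** The permutations that contribute are those that send some pair of positions to
    the indices 0 and 1. Exchanging that pair with the first one is an even
    permutation, and exchanging its two members is compensated by antisymmetry,
    so each of the 2(m+1) positions of the index 0 contributes the same amount. *)
Lemma pfaffian_split (m : nat) (A : 'M[R]_(m.+1.*2)) :
    (forall k l, A l k = - A k l) ->
    (forall k, A (ev ord0) k != 0 -> k = od ord0) ->
  pfaffian A = (m.+1.*2)%:R * A (ev ord0) (od ord0)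
               * pfaffian (\matrix_(k, l) A (lift2 k) (lift2 l)).
Proof.
move=> antiA splitA.
pose term (s : 'S_(m.+1.*2)) :=
  (-1) ^+ s * \prod_(i < m.+1) A (s (ev i)) (s (od i)).
pose e0 : 'I_(m.+1.*2) := ev ord0; pose o0 : 'I_(m.+1.*2) := od ord0.
pose T := \sum_(s : 'S_(m.+1.*2) | s e0 == e0) term s.
have sum_ev i : \sum_(s : 'S_(m.+1.*2) | s (ev i) == e0) term s = T.
  (* exchanges the first pair of positions with the i-th one *)
  pose al : 'S_(m.+1.*2) := (tperm e0 (ev i) * tperm o0 (od i))%g.
  have al_ev j : al (ev j) = ev (tperm ord0 i j).
    have -> : al (ev j) = tperm o0 (od i) (ev (tperm ord0 i j)).
      rewrite permM -(@inj_tperm _ _ (fun j => ev j) ord0 i j) //.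
      by move=> ? ? [] /double_inj ?; apply: val_inj.
    by rewrite tpermD // -val_eqE /=; lia.
  have al_od j : al (od j) = od (tperm ord0 i j).
    rewrite permM (_ : tperm e0 (ev i) (od j) = od j); last first.
      by rewrite tpermD // -val_eqE /=; lia.
    rewrite -(@inj_tperm _ _ (fun j => od j) ord0 i j) //.
    by move=> ? ? [] /double_inj ?; apply: val_inj.
  have odd_al : odd_perm al = false.
    by rewrite odd_permM !odd_tperm -!val_eqE /= eqSS addbb.
  rewrite (reindex_inj (mulgI al)) /=; apply: eq_big => s.
    by rewrite permM al_ev tpermR.
  move=> _; rewrite /term odd_permM odd_al /=; congr (_ * _).
  rewrite [RHS](reindex_perm (tperm ord0 i)) /=.
  by apply: eq_bigr => j _; rewrite !(permM al s) al_ev al_od.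
have sum_od i : \sum_(s : 'S_(m.+1.*2) | s (od i) == e0) term s = T.
  rewrite -(sum_ev i) (reindex_inj (mulgI (tperm (ev i) (od i)))) /=.
  apply: eq_big => s; first by rewrite permM tpermR.
  move=> _; rewrite /term odd_permM odd_tperm -val_eqE /= neq_ltn ltnSn /=.
  rewrite (bigD1 i) //= [in RHS](bigD1 i) //= !permM tpermL tpermR antiA.
  rewrite (_ : (-1) ^+ (~~ odd_perm s) = - (-1) ^+ odd_perm s); last first.
    by case: (odd_perm s); rewrite /= ?expr0 ?expr1 ?opprK.
  rewrite mulNr mulNr mulrN opprK; congr (_ * (_ * _)).
  apply: eq_bigr => j ji.
  by rewrite !permM !tpermD //; move: ji; rewrite -!val_eqE /=; lia.
have -> : pfaffian A = (m.+1.*2)%:R * T.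
  rewrite /pfaffian (partition_big (fun s : 'S_(m.+1.*2) => s^-1%g e0) predT) //=.
  transitivity (\sum_(k < m.+1.*2) T); last first.
    by rewrite sumr_const card_ord mulr_natl.
  rewrite !big_ord_double; apply: eq_bigr => i _; rewrite -{1}(sum_ev i) -(sum_od i).
  by congr (_ + _); apply: eq_bigl => s; rewrite eq_sym -(can2_eq (permK s) (permKV s)).
rewrite -mulrA; congr (_ * _).
have -> : T = \sum_(s : 'S_(m.+1.*2) | (s e0 == e0) && (s o0 == o0)) term s.
  rewrite /T (bigID (fun s : 'S_(m.+1.*2) => s o0 == o0)) /= [X in _ + X]big1 ?addr0 //.
  move=> s /andP[/eqP s0 s1]; rewrite /term big_ord_recl s0.
  suff -> : A e0 (s o0) = 0 by rewrite mul0r mulr0.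
  by apply/eqP; apply: contraNT s1 => /splitA /eqP.
have o0E : o0 = lift (ord0 : 'I_(m.*2).+2) ord0 by apply: val_inj.
have e0E : e0 = (ord0 : 'I_(m.*2).+2) by apply: val_inj.
rewrite big_mkcondr e0E (@sum_perm_fix0 _ m.*2.+1) /=.
under eq_bigr do rewrite o0E lift_perm_lift (inj_eq lift_inj).
rewrite -big_mkcond sum_perm_fix0 mulr_sumr; apply: eq_bigr => s _.
rewrite /term !odd_lift_perm /= big_ord_recl mulrCA.
congr (_ * (_ * _)).
  by congr (A _ _); rewrite -/e0 -/o0 ?e0E ?o0E ?lift_perm_lift ?lift_perm_id.
apply: eq_bigr => i _; rewrite mxE.
have -> : ev (lift ord0 i) = lift2 (ev i) by apply: val_inj.
have -> : od (lift ord0 i) = lift2 (od i) by apply: val_inj.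
by rewrite /lift2 !lift_perm_lift.
Qed.

End Pfaffian.

(** * Frames and coordinates in phase space *)

Section Frames.

Definition frame (T : Type) (m : nat) (a b : T) (v : 'I_(m.*2) -> T)
    (k : 'I_(m.+1.*2)) : T :=
  if unlift (ord0 : 'I_(m.*2).+2) k is Some l then
    if unlift ord0 l is Some l' then v l' else b
  else a.

Variables (T : Type) (m : nat) (a b : T) (v : 'I_(m.*2) -> T).

Lemma frame_ev0 : frame a b v (ev ord0) = a.
Proof.
rewrite /frame (_ : ev ord0 = (ord0 : 'I_(m.*2).+2)) ?unlift_none //.
exact: val_inj.
Qed.

Lemma frame_od0 : frame a b v (od ord0) = b.
Proof.
rewrite /frame (_ : od ord0 = lift (ord0 : 'I_(m.*2).+2) ord0); last exact: val_inj.
by rewrite liftK unlift_none.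
Qed.

Lemma frame_lift k : frame a b v (lift ord0 (lift ord0 k)) = v k.
Proof. by rewrite /frame !liftK. Qed.

Lemma frame_ind (P : 'I_(m.+1.*2) -> Prop) :
  P (ev ord0) -> P (od ord0) ->
  (forall k : 'I_(m.*2), P (lift ord0 (lift ord0 k))) -> forall k, P k.
Proof.
move=> P0 P1 P2 k.
case: (unliftP (ord0 : 'I_(m.*2).+2) k) => [l|] ->; last first.
  by rewrite (_ : ord0 = ev ord0) //; apply: val_inj.
case: (unliftP ord0 l) => [l'|] ->; first exact: P2.
by rewrite (_ : lift ord0 ord0 = od ord0) //; apply: val_inj.
Qed.

End Frames.

Section Phase_space.
Context {R : realType} {n : nat}.
Implicit Types (u v w x : phase R n) (q : 'cV[R]_n).

Definition coord_phase (k : 'I_(n.*2)) (w : phase R n) : R :=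
  interleave (w.1 ^~ 0) (w.2 ^~ 0) k.

Definition phase_basis : 'I_(n.*2) -> phase R n :=
  interleave (fun i => (delta_mx i 0, 0)) (fun i => (0, delta_mx i 0)).

Definition coord_mx (m : nat) (v : 'I_m -> phase R n) : 'M[R]_(m, n.*2) :=
  \matrix_(k, c) coord_phase c (v k).

Lemma coord_ev i w : coord_phase (ev i) w = w.1 i 0.
Proof. exact: interleave_ev. Qed.

Lemma coord_od i w : coord_phase (od i) w = w.2 i 0.
Proof. exact: interleave_od. Qed.

Lemma coordD k u v : coord_phase k (u + v) = coord_phase k u + coord_phase k v.
Proof. by rewrite /coord_phase /interleave; case: ifP => _; rewrite mxE. Qed.

Lemma coordN k u : coord_phase k (- u) = - coord_phase k u.
Proof. by rewrite /coord_phase /interleave; case: ifP => _; rewrite mxE. Qed.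

Lemma coordZ k (a : R) u : coord_phase k (a *: u) = a * coord_phase k u.
Proof. by rewrite /coord_phase /interleave; case: ifP => _; rewrite mxE. Qed.

Lemma coord_sum (I : Type) (r : seq I) (P : pred I) (F : I -> phase R n) k :
  coord_phase k (\sum_(i <- r | P i) F i) = \sum_(i <- r | P i) coord_phase k (F i).
Proof.
apply: (big_morph _ (coordD k)).
by rewrite /coord_phase /interleave; case: ifP => _; rewrite mxE.
Qed.

Lemma coord_inj u v : (forall k, coord_phase k u = coord_phase k v) -> u = v.
Proof.
move: u v => [u1 u2] [v1 v2] e; congr pair; apply/matrixP => i j; rewrite ord1.
  by have := e (ev i); rewrite !coord_ev.
by have := e (od i); rewrite !coord_od.
Qed.

Lemma phase_decomp w : w = \sum_k coord_phase k w *: phase_basis k.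
Proof.
apply: coord_inj => k; rewrite coord_sum.
under eq_bigr do rewrite coordZ.
rewrite (bigD1 k) //= big1 => [|l lk].
  rewrite addr0 (_ : coord_phase k (phase_basis k) = 1) ?mulr1 //.
  by rewrite /coord_phase /phase_basis /interleave; case: (odd k); rewrite mxE !eqxx.
rewrite /phase_basis /coord_phase /interleave.
have [ho|ho] := boolP (half_ord l == half_ord k); last first.
  by case: (odd k); case: (odd l); rewrite /= !mxE ?(negPf ho) ?mulr0 //
     eq_sym (negPf ho) mulr0.
suff : odd k != odd l by case: (odd k); case: (odd l) => // _; rewrite /= !mxE mulr0.
apply: contraNneq lk => e; apply/eqP/val_inj => /=.
rewrite -[val l]odd_double_half -[val k]odd_double_half -e.
by move/eqP/(congr1 val): ho => /= ->.
Qed.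

Lemma dotC (a b : 'cV[R]_n) : dot a b = dot b a.
Proof. by apply: eq_bigr => i _; rewrite mulrC. Qed.

Lemma dotDr (c a b : 'cV[R]_n) : dot c (a + b) = dot c a + dot c b.
Proof. by rewrite /dot -big_split; apply: eq_bigr => i _; rewrite mxE mulrDr. Qed.

Lemma dotZr (c a : 'cV[R]_n) k : dot c (k *: a) = k * dot c a.
Proof. by rewrite /dot mulr_sumr; apply: eq_bigr => i _; rewrite mxE mulrCA. Qed.

Lemma dotNr (c a : 'cV[R]_n) : dot c (- a) = - dot c a.
Proof. by rewrite -scaleN1r dotZr mulN1r. Qed.

Lemma dotBr (c a b : 'cV[R]_n) : dot c (a - b) = dot c a - dot c b.
Proof. by rewrite dotDr dotNr. Qed.

Lemma dot0r (c : 'cV[R]_n) : dot c 0 = 0.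
Proof. by rewrite -(scale0r 0) dotZr mul0r. Qed.

Lemma dotDl (c a b : 'cV[R]_n) : dot (a + b) c = dot a c + dot b c.
Proof. by rewrite dotC dotDr !(dotC c). Qed.

Lemma dotZl (c a : 'cV[R]_n) k : dot (k *: a) c = k * dot a c.
Proof. by rewrite dotC dotZr dotC. Qed.

Lemma dotNl (c a : 'cV[R]_n) : dot (- a) c = - dot a c.
Proof. by rewrite dotC dotNr dotC. Qed.

Lemma dot0l (c : 'cV[R]_n) : dot 0 c = 0.
Proof. by rewrite dotC dot0r. Qed.

Lemma dot_delta (c : 'cV[R]_n) i : dot c (delta_mx i 0) = c i 0.
Proof.
rewrite /dot (bigD1 i) //= mxE !eqxx mulr1 big1 ?addr0 // => j ji.
by rewrite mxE (negPf ji) mulr0.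
Qed.

Lemma cotangent_sphereE x :
  cotangent_sphere x <-> dot x.1 x.1 = 1 /\ dot x.1 x.2 = 0.
Proof.
have dot_ge0 : 0 <= dot x.1 x.1 by apply: sumr_ge0 => i _; rewrite -expr2 sqr_ge0.
split=> -[h1 h2]; split=> //.
  by rewrite -[LHS]sqr_sqrtr // -/(enorm x.1) h1 expr1n.
by rewrite /enorm h1 sqrtr1.
Qed.

Definition symplectic_mx : 'M[R]_(n.*2) :=
  \matrix_(k, l) canonical_form (phase_basis k) (phase_basis l).

Lemma canonical_form_coord (m : nat) (v : 'I_m -> phase R n) :
  \matrix_(k, l) canonical_form (v k) (v l) =
  coord_mx v *m symplectic_mx *m (coord_mx v)^T.
Proof.
have formDl u u' w : canonical_form (u + u') w = canonical_form u w + canonical_form u' w.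
  by rewrite /canonical_form dotDl dotDr; ring.
have formZl a u w : canonical_form (a *: u) w = a * canonical_form u w.
  by rewrite /canonical_form dotZl dotZr; ring.
have formC u w : canonical_form u w = - canonical_form w u.
  by rewrite /canonical_form opprB.
have form_suml (I : finType) (F : I -> phase R n) w :
    canonical_form (\sum_i F i) w = \sum_i canonical_form (F i) w.
  apply: (big_morph (fun u => canonical_form u w)) => //.
  by rewrite /canonical_form !dot0l dot0r subr0.
apply/matrixP => k l; rewrite mxE [in LHS](phase_decomp (v k)) form_suml.
rewrite -mulmxA mxE; apply: eq_bigr => c _; rewrite formZl !mxE; congr (_ * _).
rewrite [in LHS](phase_decomp (v l)) formC form_suml -sumrN; apply: eq_bigr => d _.
by rewrite !mxE formZl formC mulrN opprK mulrC.
Qed.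

(** The Hamiltonian vector field of q.p; it generates the cotangent lift of the
    dilations of R^n. *)
Definition dilation x : phase R n := (x.1, - x.2).
(** The Hamiltonian vector field of - q.q / 2. *)
Definition fiber_shift x : phase R n := (0, x.1).

End Phase_space.

(** * The Liouville form as a determinant *)

Section Liouville.
Context {R : realType} {m : nat}.
Implicit Types x : phase R m.+1.

Definition frame_det x (v : 'I_(m.*2) -> phase R m.+1) : R :=
  \det (coord_mx (frame (dilation x) (fiber_shift x) v)).

(** In the Gram matrix of the frame for the canonical form, the first two vectors
    are orthogonal to the others and pair to q.q = 1; [pfaffian_split] then leaves
    the Pfaffian of [v], while [pfaffian_congr] computes the whole. *)
Lemma liouville_form_det : exists K : R, forall x v,
  cotangent_sphere x -> (forall i, tangent x (v i)) ->
  liouville_form x v = K * frame_det x v.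
Proof.
exists (pfaffian (m := m.+1) symplectic_mx / (2 ^+ m * (m.+1.*2)%:R)) => x v.
move=> /cotangent_sphereE[qq qp] tan_v.
have := pfaffian_congr (m := m.+1)
  (coord_mx (frame (dilation x) (fiber_shift x) v)) symplectic_mx.
rewrite -canonical_form_coord pfaffian_split; last 2 first.
- by move=> k l; rewrite !mxE /canonical_form opprB.
- move=> k; apply: contraNeq; rewrite mxE frame_ev0 /canonical_form /=.
  elim/frame_ind: k => [_||k _].
  + by rewrite frame_ev0 /= dotNr dotC subrr.
  + by rewrite eqxx.
  + rewrite frame_lift dotNr opprK addrC; apply/eqP; exact: (tan_v k).2.
rewrite !mxE frame_ev0 frame_od0 /canonical_form /= dot0l subr0 qq mulr1.
set A := \matrix_(_, _) _.
have -> : A = \matrix_(k, l) canonical_form (v k) (v l).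
  by apply/matrixP => k l; rewrite !mxE !frame_lift.
rewrite /liouville_form /exterior_power -/(frame_det x v) /pfaffian.
under eq_bigr => s _.
  under eq_bigr => i _ do rewrite mxE.
  over.
move=> /= e.
have nz : (m.+1.*2)%:R != 0 :> R by rewrite pnatr_eq0.
have nz2 : 2 ^+ m != 0 :> R by rewrite expf_neq0 // pnatr_eq0.
apply: (mulfI nz); apply: (mulfI nz2).
rewrite mulrCA (mulrA (2 ^+ m)) mulfV // mul1r e; field.
by rewrite nz nz2.
Qed.

End Liouville.

(** * Variation of a determinant *)

Section Determinant_variation.
Variable R : comNzRingType.

Definition set_row (n : nat) (M : 'M[R]_n) (k : 'I_n) (r : 'rV[R]_n) : 'M[R]_n :=
  \matrix_(i, j) if i == k then r 0 j else M i j.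

Lemma det_set_row (n : nat) (M : 'M[R]_n) k r :
  \det (set_row M k r) = \sum_j r 0 j * cofactor M k j.
Proof.
rewrite (expand_det_row _ k); apply: eq_bigr => j _; rewrite mxE eqxx.
rewrite /cofactor; congr (_ * (_ * \det _)); apply/matrixP => a b.
by rewrite !mxE eq_sym (negPf (neq_lift _ _)).
Qed.

Lemma sum_det_set_row_mul (n : nat) (M L : 'M[R]_n) :
  \sum_k \det (set_row M k (row k (M *m L))) = \tr L * \det M.
Proof.
transitivity (\tr (M *m L *m \adj M)).
  apply: eq_bigr => k _; rewrite det_set_row [RHS]mxE; apply: eq_bigr => j _.
  by rewrite !mxE.
by rewrite -mulmxA mxtrace_mulC -mulmxA mul_adj_mx mul_mx_scalar mxtraceZ [RHS]mulrC.
Qed.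

(** If the rows of [M] move with velocity [D], comparing [D] with the image of [M]
    under a linear map [L] separates the trace of [L] from a correction in which
    only the rows that do not follow [L] contribute. *)
Lemma sum_det_set_row (n : nat) (M D L : 'M[R]_n) :
  \sum_k \det (set_row M k (row k D)) =
  \tr L * \det M + \sum_k \det (set_row M k (row k (D - M *m L))).
Proof.
rewrite -sum_det_set_row_mul -big_split; apply: eq_bigr => k _ /=.
rewrite !det_set_row -big_split; apply: eq_bigr => j _ /=.
rewrite -mulrDl; congr (_ * _); rewrite !mxE; ring.
Qed.

End Determinant_variation.

Lemma det_eq0_of_mul_col (F : fieldType) (n : nat) (M : 'M[F]_n) (c : 'cV[F]_n) :
  c != 0 -> M *m c = 0 -> \det M = 0.
Proof.
move=> c0 Mc; apply/eqP; rewrite -det_tr; apply/det0P; exists c^T.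
  by rewrite -(inj_eq (can_inj trmxK)) trmxK trmx0.
by rewrite -trmx_mul Mc trmx0.
Qed.

(** * The Veselova field and its linearization *)

Section Field.
Context {R : realType} {n : nat}.
Variable J : 'rV[R]_n.
Hypothesis J_gt0 : forall i, 0 < J 0 i.
Implicit Types (q p u : 'cV[R]_n) (x w : phase R n).

Definition inertia q : 'cV[R]_n := diag_mx J *m q.
Definition qJq q : R := dot q (inertia q).
Definition Ccoef q (i : 'I_n) : R := (J 0 i + qJq q)^-1.
Definition Cvec q u : 'cV[R]_n := \col_i (Ccoef q i * u i 0).
Definition qCq q : R := dot q (Cvec q q).
(** The coefficient of q in the equations, which keeps the velocity tangent to the
    sphere. *)
Definition multiplier x : R := dot x.2 (Cvec x.1 x.1) / qCq x.1.
Definition veloc x : 'cV[R]_n := Cvec x.1 (x.2 - multiplier x *: x.1).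

Lemma inertiaE q i : inertia q i 0 = J 0 i * q i 0.
Proof. by rewrite /inertia mul_diag_mx mxE. Qed.

Lemma dot_gt0 q : q != 0 -> 0 < dot q q.
Proof.
move=> q0; rewrite lt_def sumr_ge0 ?andbT => [|i _]; last by rewrite -expr2 sqr_ge0.
apply: contra q0 => /eqP; move/psumr_eq0P => h; apply/eqP/matrixP => i j.
rewrite ord1 mxE; apply/eqP; rewrite -sqrf_eq0 expr2 h // => k _.
by rewrite -expr2 sqr_ge0.
Qed.

Lemma weighted_dot_gt0 (c : 'I_n -> R) q :
  (forall i, 0 < c i) -> q != 0 -> 0 < dot q (\col_i (c i * q i 0)).
Proof.
move=> c_gt0 q0.
pose r := \col_i (Num.sqrt (c i) * q i 0).
have -> : dot q (\col_i (c i * q i 0)) = dot r r.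
  apply: eq_bigr => i _; rewrite !mxE mulrACA -expr2 sqr_sqrtr ?(ltW (c_gt0 i)) //.
  by rewrite mulrCA.
apply: dot_gt0; apply: contra q0 => /eqP/matrixP h; apply/eqP/matrixP => i j.
have /eqP := h i 0; rewrite ord1 !mxE mulf_eq0 => /orP[|/eqP -> //].
by rewrite sqrtr_eq0 leNgt c_gt0.
Qed.

Lemma qJq_ge0 q : 0 <= qJq q.
Proof.
apply: sumr_ge0 => i _; rewrite inertiaE mulrCA mulr_ge0 ?(ltW (J_gt0 i)) //.
by rewrite -expr2 sqr_ge0.
Qed.

Lemma J_qJq_gt0 q i : 0 < J 0 i + qJq q.
Proof. by rewrite ltr_pwDl ?qJq_ge0. Qed.

Lemma Ccoef_gt0 q i : 0 < Ccoef q i.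
Proof. by rewrite invr_gt0 J_qJq_gt0. Qed.

Lemma qCq_gt0 q : q != 0 -> 0 < qCq q.
Proof. by apply: weighted_dot_gt0 => i; apply: Ccoef_gt0. Qed.

Lemma CmxE q : Cmx J q = diag_mx (\row_i Ccoef q i).
Proof.
set A := diag_mx J + (qJq q)%:M.
have AC : A *m diag_mx (\row_i Ccoef q i) = 1%:M.
  rewrite /A -diag_const_mx -linearD mulmx_diag -diag_const_mx; congr diag_mx.
  by apply/rowP => i; rewrite !mxE mulfV // gt_eqF // J_qJq_gt0.
have [uA _] := mulmx1_unit AC.
rewrite /Cmx -/(inertia q) -/(qJq q) -/A -[RHS]mul1mx -(mulVmx uA).
by rewrite -mulmxA AC mulmx1.
Qed.

Lemma Cmx_mul q u : Cmx J q *m u = Cvec q u.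
Proof. by rewrite CmxE; apply/colP => i; rewrite mul_diag_mx !mxE. Qed.

Lemma det_Cmx q : \det (Cmx J q) = \prod_i Ccoef q i.
Proof. by rewrite CmxE det_diag; apply: eq_bigr => i _; rewrite mxE. Qed.

Lemma dot_Cvec q u v : dot u (Cvec q v) = dot (Cvec q u) v.
Proof. by apply: eq_bigr => i _; rewrite !mxE mulrCA mulrA. Qed.

(** This is C J = Id - (q.Jq) C, the form in which the definition of C enters the
    computation of the divergence. *)
Lemma dot_inertia_Cvec q u :
  dot (inertia q) (Cvec q u) = dot q u - qJq q * dot q (Cvec q u).
Proof.
rewrite /dot mulr_sumr -sumrB; apply: eq_bigr => i _.
have nz : J 0 i + qJq q != 0 by rewrite gt_eqF ?J_qJq_gt0.
by rewrite inertiaE mxE /Ccoef; field.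
Qed.

Lemma hamiltonianE x :
  hamiltonian J x =
  (dot x.2 (Cvec x.1 x.2) - dot x.2 (Cvec x.1 x.1) ^+ 2 / qCq x.1) / 2.
Proof. by case: x => q p; rewrite /= !Cmx_mul. Qed.

Lemma veselova_fieldE x :
  veselova_field J x = (veloc x, (- 2 * hamiltonian J x) *: x.1).
Proof. by case: x => q p; rewrite /= !Cmx_mul. Qed.

Lemma veselova_densityE x :
  veselova_density J x = Num.sqrt ((\prod_i Ccoef x.1 i) / qCq x.1).
Proof. by case: x => q p; rewrite /= !Cmx_mul det_Cmx. Qed.

Lemma dot_veloc u x : dot u (veloc x) =
  dot (Cvec x.1 x.2) u - multiplier x * dot (Cvec x.1 x.1) u.
Proof. by rewrite /veloc dot_Cvec dotBr dotZr !(dotC (Cvec _ u)) !dot_Cvec. Qed.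

Section At_point.
Variable x : phase R n.
Hypothesis q_neq0 : x.1 != 0.
Local Notation q := (x.1).
Local Notation p := (x.2).
Let qCq_neq0 : qCq q != 0. Proof. by rewrite gt_eqF ?qCq_gt0. Qed.

Lemma multiplier_qCq : multiplier x * qCq q = dot p (Cvec q q).
Proof. by rewrite /multiplier divfK. Qed.

(** The multiplier is chosen for this; the identity holds off the sphere too,
    so it may be differentiated in all directions. *)
Lemma dot_q_veloc : dot q (veloc x) = 0.
Proof. by rewrite dot_veloc -!dot_Cvec multiplier_qCq dot_Cvec dotC dot_Cvec subrr. Qed.

Lemma dot_p_veloc : dot p (veloc x) = 2 * hamiltonian J x.
Proof.
rewrite hamiltonianE mulrCA mulfV ?mulr1 ?pnatr_eq0 // dot_veloc.
by rewrite -!dot_Cvec (dotC q) -dot_Cvec /multiplier; field.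
Qed.

(** The [d_] functions are the differentials at [x], in the direction [w], of
    q.Jq, q.Cq, p.Cq, the multiplier, the velocity, the Hamiltonian and the field.
    They all come from dC = - d(q.Jq) C^2. *)
Definition d_qJq (w : phase R n) : R := 2 * dot (inertia q) w.1.
Definition pC2q : R := dot (Cvec q p) (Cvec q q).
Definition qC2q : R := dot (Cvec q q) (Cvec q q).
Definition d_qCq (w : phase R n) : R := 2 * dot (Cvec q q) w.1 - d_qJq w * qC2q.
Definition d_pCq (w : phase R n) : R :=
  dot (Cvec q p) w.1 + dot (Cvec q q) w.2 - d_qJq w * pC2q.
Definition d_multiplier (w : phase R n) : R := (d_pCq w - multiplier x * d_qCq w) / qCq q.
Definition d_veloc (w : phase R n) : 'cV[R]_n :=
  Cvec q (w.2 - d_multiplier w *: q - multiplier x *: w.1 - d_qJq w *: veloc x).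
Definition d_ham (w : phase R n) : R :=
  (2 * dot (Cvec q p) w.2 - d_qJq w * dot (Cvec q p) (Cvec q p)
   - 2 * multiplier x * d_pCq w + multiplier x ^+ 2 * d_qCq w) / 2.
Definition d_field (w : phase R n) : phase R n :=
  (d_veloc w, -2 *: (d_ham w *: q + hamiltonian J x *: w.1)).

(** The value on T^*S^(n-1) of the ambient divergence of the field; see
    [trace_d_field]. *)
Definition divergence : R := pC2q / qCq q - multiplier x * \sum_i Ccoef q i.

Lemma d_qJq_lin a (u w : phase R n) : d_qJq (a *: u + w) = a * d_qJq u + d_qJq w.
Proof. by rewrite /d_qJq dotDr dotZr; ring. Qed.

Lemma d_qCq_lin a (u w : phase R n) : d_qCq (a *: u + w) = a * d_qCq u + d_qCq w.
Proof. by rewrite /d_qCq d_qJq_lin dotDr dotZr; ring. Qed.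

Lemma d_pCq_lin a (u w : phase R n) : d_pCq (a *: u + w) = a * d_pCq u + d_pCq w.
Proof. by rewrite /d_pCq d_qJq_lin !dotDr !dotZr; ring. Qed.

Lemma d_multiplier_lin a (u w : phase R n) :
  d_multiplier (a *: u + w) = a * d_multiplier u + d_multiplier w.
Proof. by rewrite /d_multiplier d_pCq_lin d_qCq_lin; ring. Qed.

Lemma d_ham_lin a (u w : phase R n) : d_ham (a *: u + w) = a * d_ham u + d_ham w.
Proof. by rewrite /d_ham d_qJq_lin d_pCq_lin d_qCq_lin !dotDr !dotZr; ring. Qed.

Lemma d_field_lin a (u w : phase R n) : d_field (a *: u + w) = a *: d_field u + d_field w.
Proof.
rewrite /d_field; congr pair; apply/colP => i.
  by rewrite !mxE d_multiplier_lin d_qJq_lin; ring.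
by rewrite !mxE d_ham_lin; ring.
Qed.

Lemma d_field_sum (I : finType) (a : I -> R) (F : I -> phase R n) :
  d_field (\sum_i a i *: F i) = \sum_i a i *: d_field (F i).
Proof.
have d_field0 : d_field 0 = 0.
  by have := d_field_lin (-1) 0 0; rewrite scaler0 add0r scaleN1r addNr.
elim/big_rec2: _ => // i y1 y2 _ <-; exact: d_field_lin.
Qed.

(** The derivative of the identity q.V = 0. *)
Lemma dot_q_d_veloc w : dot q (d_veloc w) = - dot (veloc x) w.1.
Proof.
rewrite (dotC (veloc _)) dot_veloc /d_veloc dot_Cvec !dotBr !dotZr dot_veloc.
rewrite (dotC (Cvec q q) q) -/(qCq q) -/pC2q -/qC2q /d_multiplier.
rewrite [X in _ - X - _ - _](_ : _ = d_pCq w - multiplier x * d_qCq w); last first.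
  by rewrite divfK.
by rewrite /d_qCq /d_pCq; ring.
Qed.

(** The projection in the velocity removes the component of p along q, and so
    does the one in the Hamiltonian: the field is invariant under translations
    of p along q. *)
Lemma d_field_0q : d_field (0, q) = 0.
Proof.
have s0 : d_qJq (0, q) = 0 by rewrite /d_qJq dot0r mulr0.
have k0 : d_qCq (0, q) = 0 by rewrite /d_qCq s0 dot0r; ring.
have m0 : d_pCq (0, q) = qCq q by rewrite /d_pCq s0 dot0r (dotC (Cvec q q)) /qCq; ring.
have l0 : d_multiplier (0, q) = 1 by rewrite /d_multiplier k0 m0 mulr0 subr0 divff.
have h0 : d_ham (0, q) = 0.
  rewrite /d_ham s0 k0 m0 -mulrA multiplier_qCq -dot_Cvec /=; ring.
rewrite /d_field h0 /d_veloc s0 l0 /= !scaler0 !scale0r scale1r subrr !subr0.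
rewrite addr0 scaler0; congr pair; apply/colP => i; rewrite !mxE; ring.
Qed.

(** The momentum part of the trace is - 2 q.V = 0, since the gradient of the
    Hamiltonian in p is the velocity V. The position part is reduced by
    [dot_inertia_Cvec] to p.C^2 q, q.C^2 q and q.Cq, and q.C^2 q cancels. *)
Lemma trace_d_field : dot q q = 1 ->
  \sum_(k < n.*2) coord_phase k (d_field (phase_basis k)) = divergence.
Proof.
move=> qq; rewrite /divergence big_ord_double big_split /=.
have -> : \sum_(i < n) coord_phase (od i) (d_field (phase_basis (od i))) = 0.
  transitivity (-2 * dot q (veloc x)); last by rewrite dot_q_veloc mulr0.
  rewrite /dot mulr_sumr; apply: eq_bigr => i _.
  rewrite coord_od /phase_basis interleave_od !mxE.
  by rewrite /d_ham /d_pCq /d_qCq /d_qJq /veloc /= !dot0r !dot_delta !mxE; field.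
rewrite addr0.
(* dl i is the derivative of the multiplier in the i-th direction of q *)
pose dl i := (Cvec q p i 0 - 2 * inertia q i 0 * pC2q
  - multiplier x * (2 * Cvec q q i 0 - 2 * inertia q i 0 * qC2q)) / qCq q.
transitivity (\sum_i (- (dl i * Cvec q q i 0) - multiplier x * Ccoef q i
    - 2 * (inertia q i 0 * Cvec q (veloc x) i 0))).
  apply: eq_bigr => i _; rewrite coord_ev /phase_basis interleave_ev /= !mxE.
  rewrite /d_multiplier /d_pCq /d_qCq /d_qJq /= dot0r !dot_delta !eqxx /dl !mxE /=.
  by field.
have dlE : \sum_i dl i * Cvec q q i 0 = (pC2q - 2 * dot (inertia q) (Cvec q q) * pC2q
  - multiplier x * (2 * qC2q - 2 * dot (inertia q) (Cvec q q) * qC2q)) / qCq q.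
  rewrite /dl; under eq_bigr do rewrite mulrAC; rewrite -mulr_suml; congr (_ / _).
  transitivity (\sum_i (Cvec q p i 0 * Cvec q q i 0
      + (2 * multiplier x * qC2q - 2 * pC2q) * (inertia q i 0 * Cvec q q i 0)
      + (- 2 * multiplier x) * (Cvec q q i 0 * Cvec q q i 0))).
    by apply: eq_bigr => i _; ring.
  rewrite !big_split -!mulr_sumr /= -/(dot (Cvec q p) _) -/(dot (inertia q) _).
  rewrite -/(dot (Cvec q q) _) -/pC2q -/qC2q; ring.
rewrite !sumrB sumrN dlE -!mulr_sumr -/(dot (inertia q) (Cvec q (veloc x))).
rewrite !dot_inertia_Cvec qq dot_q_veloc (dot_Cvec q q (veloc x)) dot_veloc.
rewrite -/pC2q -/qC2q -/(qCq q).
by field.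
Qed.

Lemma dot_inertia_veloc : dot q q = 1 -> dot q p = 0 ->
  dot (inertia q) (veloc x) = - multiplier x.
Proof.
move=> qq qp; rewrite {1}/veloc dot_inertia_Cvec -/(veloc x) dot_q_veloc.
by rewrite dotBr dotZr qq qp; ring.
Qed.

Lemma d_qJq_field : dot q q = 1 -> dot q p = 0 ->
  d_qJq (veselova_field J x) = - 2 * multiplier x.
Proof.
by move=> qq qp; rewrite veselova_fieldE /d_qJq /= dot_inertia_veloc //; ring.
Qed.

Lemma d_qCq_field : dot q q = 1 -> dot q p = 0 ->
  d_qCq (veselova_field J x) = 2 * pC2q.
Proof.
move=> qq qp; rewrite /d_qCq d_qJq_field // veselova_fieldE /= dot_veloc -/pC2q -/qC2q.
ring.
Qed.

End At_point.

Lemma base_neq0 x : cotangent_sphere x -> x.1 != 0.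
Proof.
move=> /cotangent_sphereE[qq _].
by apply: contra_eq_neq qq => ->; rewrite dot0l eq_sym oner_neq0.
Qed.

Lemma veselova_tangent x : cotangent_sphere x -> tangent x (veselova_field J x).
Proof.
move=> xS; have [qq qp] := (cotangent_sphereE x).1 xS; have q0 := base_neq0 xS.
rewrite veselova_fieldE; split; rewrite /= ?dot_q_veloc //.
rewrite dotC dot_p_veloc // dotZr qq; ring.
Qed.

Lemma veselova_density_gt0 x : cotangent_sphere x -> 0 < veselova_density J x.
Proof.
move=> xS; rewrite veselova_densityE sqrtr_gt0 divr_gt0 ?qCq_gt0 ?base_neq0 //.
by apply: prodr_gt0 => i _; apply: Ccoef_gt0.
Qed.

End Field.

(** * The growth rate of the Liouville form *)

Section Coord_det.
Context {R : realType} {n : nat}.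
Implicit Types (c w : phase R n).

Lemma coord_pairing w c : \sum_k coord_phase k w * coord_phase k c =
  dot w.1 c.1 + dot w.2 c.2.
Proof.
rewrite big_ord_double big_split /=; congr (_ + _); apply: eq_bigr => i _.
  by rewrite !coord_ev.
by rewrite !coord_od.
Qed.

Lemma det_coord_mx_eq0 (v : 'I_(n.*2) -> phase R n) c : c != 0 ->
  (forall k, dot (v k).1 c.1 + dot (v k).2 c.2 = 0) -> \det (coord_mx v) = 0.
Proof.
move=> c0 vc; apply: (@det_eq0_of_mul_col _ _ _ (\col_k coord_phase k c)).
  apply: contra c0 => /eqP/colP h; apply/eqP/coord_inj => k.
  have := h k; rewrite !mxE => ->.
  by rewrite -[0 : phase R n](scale0r 0) coordZ mul0r.
apply/colP => k; rewrite !mxE -[RHS](vc k) -coord_pairing.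
by apply: eq_bigr => l _; rewrite !mxE.
Qed.

End Coord_det.

Section Divergence.
Context {R : realType} {m : nat}.
Variable J : 'rV[R]_m.+1.
Hypothesis J_gt0 : forall i, 0 < J 0 i.
Variables (x : phase R m.+1) (v : 'I_(m.*2) -> phase R m.+1).
Hypothesis x_sphere : cotangent_sphere x.
Hypothesis v_tangent : forall i, tangent x (v i).

(** [D] collects the velocities of the vectors of the frame when the base point
    moves along the field and the tangent vectors move with its linearization.
    The tangent rows follow the linearization exactly. For each of the other two
    the correction is a determinant all of whose rows are killed by one covector:
    (q, 0), the differential of q.q / 2, for the dilation, and (p, q), the
    differential of q.p, for the fiber shift. *)
Lemma sum_det_set_row_field :
  let M := coord_mx (frame (dilation x) (fiber_shift x) v) in
  let D := coord_mx (frame (dilation (veselova_field J x))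
    (fiber_shift (veselova_field J x)) (fun k => d_field J x (v k))) in
  \sum_k \det (set_row M k (row k D)) = divergence J x * frame_det x v.
Proof.
move=> M D; have [qq qp] := (cotangent_sphereE x).1 x_sphere.
have q0 := base_neq0 x_sphere.
pose L : 'M[R]_(m.+1.*2) := coord_mx (fun k => d_field J x (phase_basis k)).
have MLE (w : 'I_(m.+1.*2) -> phase R m.+1) :
    coord_mx w *m L = coord_mx (fun k => d_field J x (w k)).
  apply/matrixP => k c; rewrite !mxE [in RHS](phase_decomp (w k)) d_field_sum coord_sum.
  by apply: eq_bigr => l _; rewrite !mxE coordZ.
pose d1 : phase R m.+1 := dilation (veselova_field J x) - d_field J x (dilation x).
pose d2 : phase R m.+1 := fiber_shift (veselova_field J x) - d_field J x (fiber_shift x).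
have rowE k : row k (D - M *m L) = row k (coord_mx (frame (m := m) d1 d2 (fun=> 0))).
  apply/rowP => c; rewrite MLE; elim/frame_ind: k => [||k].
  - by rewrite !mxE !frame_ev0 -coordN -coordD.
  - by rewrite !mxE !frame_od0 -coordN -coordD.
  - by rewrite !mxE !frame_lift -coordN -coordD subrr.
rewrite (sum_det_set_row M D L) big1 ?addr0 => [|k _].
  by rewrite -(trace_d_field J_gt0 q0 qq); congr (_ * _); apply: eq_bigr => k _; rewrite mxE.
rewrite rowE; elim/frame_ind: k => [||k].
- have -> : set_row M (ev (ord0 : 'I_m.+1))
      (row (ev ord0) (coord_mx (frame (m := m) d1 d2 (fun=> 0)))) =
      coord_mx (frame d1 (fiber_shift x) v).
    apply/matrixP => k c; rewrite !mxE; elim/frame_ind: k => [||k].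
    + by rewrite eqxx !frame_ev0.
    + by rewrite -val_eqE /= !frame_od0.
    + by rewrite -val_eqE /= !frame_lift.
  apply: (@det_coord_mx_eq0 _ _ _ (x.1, 0)) => [|k].
    by apply: contra q0 => /eqP[->].
  rewrite /= dot0r addr0; elim/frame_ind: k => [||k].
  + rewrite frame_ev0 (_ : d1.1 = (veselova_field J x).1 - d_veloc J x (dilation x)) //.
    rewrite veselova_fieldE //= dotDl dotNl dotC (dotC (d_veloc _ _ _)).
    rewrite dot_q_d_veloc //= (dotC (veloc _ _)) dot_q_veloc //.
    by rewrite oppr0 subr0.
  + by rewrite frame_od0 dot0l.
  + by rewrite frame_lift dotC (v_tangent k).1.
- have -> : set_row M (od (ord0 : 'I_m.+1))
      (row (od ord0) (coord_mx (frame (m := m) d1 d2 (fun=> 0)))) =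
      coord_mx (frame (dilation x) d2 v).
    apply/matrixP => k c; rewrite !mxE; elim/frame_ind: k => [||k].
    + by rewrite -val_eqE /= !frame_ev0.
    + by rewrite eqxx !frame_od0.
    + by rewrite -val_eqE /= !frame_lift.
  apply: (@det_coord_mx_eq0 _ _ _ (x.2, x.1)) => [|k].
    by apply: contra q0 => /eqP[_ ->].
  rewrite /=; elim/frame_ind: k => [||k].
  + by rewrite frame_ev0 /= dotNl (dotC x.2) subrr.
  + rewrite frame_od0 /d2 /fiber_shift (d_field_0q J_gt0 q0) subr0 (veselova_fieldE J_gt0) /=.
    by rewrite dot0l add0r dotC (dot_q_veloc J_gt0 q0).
  + by rewrite frame_lift (dotC _ x.1) (v_tangent k).2.
- rewrite det_set_row big1 // => j _.
  by rewrite !mxE frame_lift -[0 : phase R _](scale0r 0) coordZ !mul0r.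
Qed.

End Divergence.

(** * Difference quotients *)

Section Slopes.
Context {R : realType} {Z : Type} (F : set_system Z) {FF : Filter F} (e : Z -> R).
Implicit Types (f g : Z -> R) (l d : R).

(** Along [F], the functions [f] and [g] tend to the same limit [l], and their
    difference is [e] times a quantity of limit [d]. With [F] the punctured
    neighborhoods of 0 and [g] constant this is differentiability; with a product
    filter it is a derivative in one variable, uniform in the other near a point. *)
Definition has_slope f g l d : Prop :=
  [/\ f @ F --> l, g @ F --> l & (fun z => (f z - g z) / e z) @ F --> d].

Lemma slope_eq f g l d f' g' l' d' : has_slope f g l d ->
  f =1 f' -> g =1 g' -> l = l' -> d = d' -> has_slope f' g' l' d'.
Proof. by move=> h /funext <- /funext <- <- <-. Qed.

Lemma slope_cst c : has_slope (fun=> c) (fun=> c) c 0.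
Proof.
split; [exact: cvg_cst|exact: cvg_cst|].
rewrite (_ : (fun=> _) = (fun=> 0)); first exact: cvg_cst.
by apply/funext => z; rewrite subrr mul0r.
Qed.

Lemma slopeD f g l d f' g' l' d' : has_slope f g l d -> has_slope f' g' l' d' ->
  has_slope (fun z => f z + f' z) (fun z => g z + g' z) (l + l') (d + d').
Proof.
move=> [f1 g1 d1] [f2 g2 d2]; split; [exact: cvgD|exact: cvgD|].
rewrite [X in X @ _ --> _](_ : _ =
    (fun z => (f z - g z) / e z) \+ (fun z => (f' z - g' z) / e z)).
  exact: cvgD.
by apply/funext => z /=; ring.
Qed.

Lemma slopeM f g l d f' g' l' d' : has_slope f g l d -> has_slope f' g' l' d' ->
  has_slope (fun z => f z * f' z) (fun z => g z * g' z) (l * l') (d * l' + l * d').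
Proof.
move=> [f1 g1 d1] [f2 g2 d2]; split; [exact: cvgM|exact: cvgM|].
rewrite [X in X @ _ --> _](_ : _ =
    ((fun z => (f z - g z) / e z) \* f') \+ (g \* (fun z => (f' z - g' z) / e z))).
  by apply: cvgD; apply: cvgM.
by apply/funext => z /=; ring.
Qed.

Lemma slopeZ c f g l d : has_slope f g l d ->
  has_slope (fun z => c * f z) (fun z => c * g z) (c * l) (c * d).
Proof. by move=> h; have := slopeM (slope_cst c) h; rewrite mul0r add0r. Qed.

Lemma slopeN f g l d : has_slope f g l d ->
  has_slope (fun z => - f z) (fun z => - g z) (- l) (- d).
Proof.
move=> [f1 g1 d1]; split; [exact: cvgN|exact: cvgN|].
rewrite [X in X @ _ --> _](_ : _ = (fun z => - ((f z - g z) / e z))).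
  exact: cvgN.
by apply/funext => z; ring.
Qed.

Lemma slopeB f g l d f' g' l' d' : has_slope f g l d -> has_slope f' g' l' d' ->
  has_slope (fun z => f z - f' z) (fun z => g z - g' z) (l - l') (d - d').
Proof. by move=> h h'; exact: slopeD h (slopeN h'). Qed.

Lemma slopeV f g l d : l != 0 -> has_slope f g l d ->
  has_slope (fun z => (f z)^-1) (fun z => (g z)^-1) l^-1 (- d / l ^+ 2).
Proof.
move=> l0 [f1 g1 d1]; split; [exact: cvgV|exact: cvgV|].
have lim : (fun z => - ((f z - g z) / e z) * ((f z)^-1 * (g z)^-1)) @ F -->
    - d * (l^-1 * l^-1).
  by apply: cvgM; [exact: cvgN|apply: cvgM; exact: cvgV].
rewrite expr2 invfM; apply: cvg_trans lim; apply: near_eq_cvg.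
near=> z.
have fz : f z != 0 by near: z; exact: (cvgr_neq0 _ f1).
have gz : g z != 0 by near: z; exact: (cvgr_neq0 _ g1).
have -> : (f z)^-1 - (g z)^-1 = - (f z - g z) * ((f z)^-1 * (g z)^-1).
  by field; rewrite fz gz.
ring.
Unshelve. all: by end_near. Qed.

Lemma slope_sqrt f g l d : 0 < l -> has_slope f g l d ->
  has_slope (fun z => Num.sqrt (f z)) (fun z => Num.sqrt (g z)) (Num.sqrt l)
    (d / (2 * Num.sqrt l)).
Proof.
move=> l0 [f1 g1 d1].
have sf : (fun z => Num.sqrt (f z)) @ F --> Num.sqrt l.
  by apply: continuous_cvg f1; apply: sqrt_continuous.
have sg : (fun z => Num.sqrt (g z)) @ F --> Num.sqrt l.
  by apply: continuous_cvg g1; apply: sqrt_continuous.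
split=> //.
have s0 : 0 < Num.sqrt l by rewrite sqrtr_gt0.
have lim : (fun z => (f z - g z) / e z * (Num.sqrt (f z) + Num.sqrt (g z))^-1) @ F -->
    d / (Num.sqrt l + Num.sqrt l).
  by apply: cvgM => //; apply: cvgV; [rewrite gt_eqF ?addr_gt0|exact: cvgD].
rewrite mulr_natl mulr2n; apply: cvg_trans lim; apply: near_eq_cvg.
near=> z.
have fz : 0 < f z by near: z; exact: (cvgr_gt _ f1).
have gz : 0 < g z by near: z; exact: (cvgr_gt _ g1).
have nz : Num.sqrt (f z) + Num.sqrt (g z) != 0.
  by rewrite gt_eqF // addr_gt0 ?sqrtr_gt0.
have -> : f z - g z =
    (Num.sqrt (f z) - Num.sqrt (g z)) * (Num.sqrt (f z) + Num.sqrt (g z)).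
  by rewrite -subr_sqr !sqr_sqrtr ?ltW.
by rewrite mulrAC mulfK.
Unshelve. all: by end_near. Qed.

Lemma slope_sum (I : Type) (r : seq I) (f g : I -> Z -> R) (l d : I -> R) :
  (forall i, has_slope (f i) (g i) (l i) (d i)) ->
  has_slope (fun z => \sum_(i <- r) f i z) (fun z => \sum_(i <- r) g i z)
    (\sum_(i <- r) l i) (\sum_(i <- r) d i).
Proof.
move=> h; elim: r => [|i r IH].
  under [fun z => _]eq_fun do rewrite big_nil.
  under [X in has_slope _ X]eq_fun do rewrite big_nil.
  by rewrite !big_nil; exact: slope_cst.
under [fun z => _]eq_fun do rewrite big_cons.
under [X in has_slope _ X]eq_fun do rewrite big_cons.
by rewrite !big_cons; exact: slopeD.
Qed.

(** The derivative is written with one factor replaced at a time so as to match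
    [set_row] in [slope_det]. *)
Lemma slope_prod (n : nat) (f g : 'I_n -> Z -> R) (l d : 'I_n -> R) :
  (forall i, has_slope (f i) (g i) (l i) (d i)) ->
  has_slope (fun z => \prod_i f i z) (fun z => \prod_i g i z)
    (\prod_i l i) (\sum_k \prod_i (if i == k then d i else l i)).
Proof.
elim: n f g l d => [|n IH] f g l d h.
  under [fun z => _]eq_fun do rewrite big_ord0.
  under [X in has_slope _ X]eq_fun do rewrite big_ord0.
  by rewrite !big_ord0; exact: slope_cst.
under [fun z => _]eq_fun do rewrite big_ord_recl.
under [X in has_slope _ X]eq_fun do rewrite big_ord_recl.
have := slopeM (h ord0) (IH _ _ _ _ (fun i => h (lift ord0 i))).
rewrite [\prod_(i < n.+1) l i]big_ord_recl [\sum_(k < n.+1) _]big_ord_recl.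
rewrite [in X in _ -> has_slope _ _ _ X]big_ord_recl /=.
set P := \sum_(k < n) _; suff -> : \sum_(i < n) \prod_(j < n.+1)
   (if j == lift ord0 i then d j else l j) = l ord0 * P by [].
by rewrite mulr_sumr; apply: eq_bigr => i _; rewrite big_ord_recl.
Qed.

Lemma slope_det (n : nat) (f g : Z -> 'M[R]_n) (M D : 'M[R]_n) :
  (forall i j, has_slope (fun z => f z i j) (fun z => g z i j) (M i j) (D i j)) ->
  has_slope (fun z => \det (f z)) (fun z => \det (g z)) (\det M)
    (\sum_k \det (set_row M k (row k D))).
Proof.
move=> h; rewrite exchange_big /=; apply: slope_sum => s.
rewrite -mulr_sumr; apply: slopeZ.
have := slope_prod (fun i => h i (s i)).
rewrite (_ : (\sum_k _) = \sum_k \prod_i set_row M k (row k D) i (s i)) //.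
apply: eq_bigr => k _; apply: eq_bigr => i _.
by rewrite !mxE; case: eqP => // ->.
Qed.

End Slopes.

(** * Derivatives of the field and of the density *)

Section Field_slopes.
Context {R : realType} {n : nat} {Z : Type} (F : set_system Z) {FF : Filter F} (e : Z -> R).
Variable J : 'rV[R]_n.
Hypothesis J_gt0 : forall i, 0 < J 0 i.

Definition vec_slope (f g : Z -> 'cV[R]_n) (u a : 'cV[R]_n) : Prop :=
  forall i, has_slope F e (fun z => f z i 0) (fun z => g z i 0) (u i 0) (a i 0).

Definition phase_slope (f g : Z -> phase R n) (x w : phase R n) : Prop :=
  vec_slope (fun z => (f z).1) (fun z => (g z).1) x.1 w.1 /\
  vec_slope (fun z => (f z).2) (fun z => (g z).2) x.2 w.2.

Lemma slope_dot f g u a f' g' u' a' : vec_slope f g u a -> vec_slope f' g' u' a' ->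
  has_slope F e (fun z => dot (f z) (f' z)) (fun z => dot (g z) (g' z))
    (dot u u') (dot a u' + dot u a').
Proof.
move=> h h'; rewrite /dot -big_split.
apply: (slope_sum _ (fun i => slopeM (h i) (h' i))).
Qed.

Lemma vec_slopeB f g u a f' g' u' a' : vec_slope f g u a -> vec_slope f' g' u' a' ->
  vec_slope (fun z => f z - f' z) (fun z => g z - g' z) (u - u') (a - a').
Proof.
by move=> h h' i; apply: slope_eq (slopeB (h i) (h' i)) _ _ _ _ => [z|z||]; rewrite !mxE.
Qed.

Lemma vec_slopeZ c c' l d f g u a : has_slope F e c c' l d -> vec_slope f g u a ->
  vec_slope (fun z => c z *: f z) (fun z => c' z *: g z) (l *: u) (d *: u + l *: a).
Proof.
by move=> h h' i; apply: slope_eq (slopeM h (h' i)) _ _ _ _ => [z|z||]; rewrite !mxE.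
Qed.

Lemma slope_qJq f g q a : vec_slope f g q a ->
  has_slope F e (fun z => qJq J (f z)) (fun z => qJq J (g z)) (qJq J q)
    (2 * dot (inertia J q) a).
Proof.
move=> h.
have h' : vec_slope (fun z => inertia J (f z)) (fun z => inertia J (g z))
    (inertia J q) (inertia J a).
  by move=> i; apply: slope_eq (slopeZ (J 0 i) (h i)) _ _ _ _ => [z|z||]; rewrite inertiaE.
apply: slope_eq (slope_dot h h') _ _ _ _ => //.
have -> : dot q (inertia J a) = dot (inertia J q) a.
  by apply: eq_bigr => i _; rewrite !inertiaE mulrCA mulrA.
rewrite dotC; ring.
Qed.

Lemma slope_Ccoef f g q a i : vec_slope f g q a ->
  has_slope F e (fun z => Ccoef J (f z) i) (fun z => Ccoef J (g z) i) (Ccoef J q i)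
    (- (2 * dot (inertia J q) a) * Ccoef J q i ^+ 2).
Proof.
move=> h; have nz : J 0 i + qJq J q != 0 by rewrite gt_eqF ?J_qJq_gt0.
apply: slope_eq (slopeV nz (slopeD (slope_cst _ (J 0 i)) (slope_qJq h))) _ _ _ _ => //.
by rewrite add0r /Ccoef exprVn.
Qed.

Lemma slope_Cvec f g q a f' g' u b : vec_slope f g q a -> vec_slope f' g' u b ->
  vec_slope (fun z => Cvec J (f z) (f' z)) (fun z => Cvec J (g z) (g' z)) (Cvec J q u)
    (Cvec J q (b - (2 * dot (inertia J q) a) *: Cvec J q u)).
Proof.
move=> h h' i; apply: slope_eq (slopeM (slope_Ccoef i h) (h' i)) _ _ _ _ => [z|z||];
  rewrite !mxE //; ring.
Qed.

Section At_point.
Variables (f g : Z -> phase R n) (x w : phase R n).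
Hypothesis x_neq0 : x.1 != 0.
Hypothesis fg : phase_slope f g x w.
Let fq := fg.1.
Let fp := fg.2.
Let fCq := slope_Cvec fq fq.
Let qCq_neq0 : qCq J x.1 != 0. Proof. by rewrite gt_eqF ?qCq_gt0. Qed.

Lemma slope_qCq :
  has_slope F e (fun z => qCq J (f z).1) (fun z => qCq J (g z).1) (qCq J x.1) (d_qCq J x w).
Proof.
apply: slope_eq (slope_dot fq fCq) _ _ _ _ => //; rewrite /d_qCq /d_qJq /qC2q.
rewrite (dotC w.1) (dot_Cvec _ _ x.1) dotBr dotZr; ring.
Qed.

Lemma slope_multiplier :
  has_slope F e (fun z => multiplier J (f z)) (fun z => multiplier J (g z))
    (multiplier J x) (d_multiplier J x w).
Proof.
apply: slope_eq (slopeM (slope_dot fp fCq) (slopeV qCq_neq0 slope_qCq)) _ _ _ _ => //.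
rewrite /d_multiplier /multiplier (_ : dot w.2 _ + _ = d_pCq J x w); first by field.
rewrite /d_pCq /d_qJq /pC2q (dotC w.2) (dot_Cvec _ _ x.2) dotBr dotZr; ring.
Qed.

Lemma slope_veloc : vec_slope (fun z => veloc J (f z)) (fun z => veloc J (g z))
  (veloc J x) (d_veloc J x w).
Proof.
have h := slope_Cvec fq (vec_slopeB fp (vec_slopeZ slope_multiplier fq)).
move=> i; apply: slope_eq (h i) _ _ _ _ => //.
by rewrite /d_veloc opprD !addrA.
Qed.

Lemma slope_ham : has_slope F e (fun z => hamiltonian J (f z)) (fun z => hamiltonian J (g z))
  (hamiltonian J x) (d_ham J x w).
Proof.
have hpp := slope_dot fp (slope_Cvec fq fp).
have hpq := slope_dot fp fCq.
have hE y : hamiltonian J y = 2^-1 *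
    (dot y.2 (Cvec J y.1 y.2) - multiplier J y * dot y.2 (Cvec J y.1 y.1)).
  by rewrite hamiltonianE // /multiplier mulrC; congr (_ * (_ - _)); ring.
apply: slope_eq (slopeZ 2^-1 (slopeB hpp (slopeM slope_multiplier hpq))) _ _ _ _
  => [z|z||]; rewrite ?hE //.
rewrite (_ : dot w.2 (Cvec J x.1 x.1) + _ = d_pCq J x w); last first.
  rewrite /d_pCq /d_qJq /pC2q (dotC w.2) (dot_Cvec _ _ x.2) dotBr dotZr; ring.
rewrite -(multiplier_qCq J_gt0 x_neq0) /d_ham.
have -> : dot w.2 (Cvec J x.1 x.2) + dot x.2 (Cvec J x.1
      (w.2 - (2 * dot (inertia J x.1) w.1) *: Cvec J x.1 x.2)) =
    2 * dot (Cvec J x.1 x.2) w.2 - d_qJq J x w * dot (Cvec J x.1 x.2) (Cvec J x.1 x.2).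
  rewrite /d_qJq (dotC w.2) (dot_Cvec _ _ x.2) dotBr dotZr; ring.
rewrite /d_multiplier; field; exact: qCq_neq0.
Qed.

Lemma slope_field : phase_slope (fun z => veselova_field J (f z))
  (fun z => veselova_field J (g z)) (veselova_field J x) (d_field J x w).
Proof.
split=> i.
  by apply: slope_eq (slope_veloc i) _ _ _ _ => [z|z||]; rewrite ?veselova_fieldE.
apply: slope_eq (vec_slopeZ (slopeZ (-2) slope_ham) fq i) _ _ _ _ => [z|z||];
  rewrite ?veselova_fieldE //.
by rewrite /= scalerDr !scalerA.
Qed.

End At_point.

(** Along the field q.Jq varies at the rate - 2 m and q.Cq at the rate 2 p.C^2 q,
    with m the multiplier, so that the logarithm of det C / (q.Cq) varies at the
    rate 2 m tr C - 2 p.C^2 q / (q.Cq), which is minus twice the divergence. *)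
Lemma slope_density f g x : cotangent_sphere x ->
  phase_slope f g x (veselova_field J x) ->
  has_slope F e (fun z => veselova_density J (f z)) (fun z => veselova_density J (g z))
    (veselova_density J x) (- divergence J x * veselova_density J x).
Proof.
move=> x_sphere fg; have [qq qp] := (cotangent_sphereE x).1 x_sphere.
have q0 := base_neq0 x_sphere; have k0 := qCq_gt0 J_gt0 q0.
have rho0 := veselova_density_gt0 J_gt0 x_sphere.
pose P := \prod_i Ccoef J x.1 i.
have P0 : 0 < P by apply: prodr_gt0 => i _; apply: Ccoef_gt0.
apply: slope_eq (slope_sqrt (divr_gt0 P0 k0)
  (slopeM (slope_prod (fun i => slope_Ccoef i fg.1))
          (slopeV (lt0r_neq0 k0) (slope_qCq fg)))) _ _ _ _ => [z|z||];
  rewrite ?veselova_densityE //.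
rewrite (_ : \sum_k _ = 2 * multiplier J x * (\sum_i Ccoef J x.1 i) * P); last first.
  rewrite -/(d_qJq J x _) d_qJq_field //.
  rewrite mulr_sumr mulr_suml; apply: eq_bigr => k _.
  have -> : P = Ccoef J x.1 k * \prod_(i | i != k) Ccoef J x.1 i by rewrite /P (bigD1 k).
  rewrite (bigD1 k) //= eqxx; rewrite (eq_bigr (Ccoef J x.1)) => [|i /negPf -> //].
  ring.
rewrite d_qCq_field // /divergence -?[\prod_i _]/P.
set s := Num.sqrt _; have s0 : 0 < s by rewrite sqrtr_gt0 divr_gt0.
have -> : P = s ^+ 2 * qCq J x.1 by rewrite sqr_sqrtr ?ltW ?divr_gt0 // divfK // gt_eqF.
by field; rewrite !gt_eqF.
Qed.

End Field_slopes.

(** * Exchange of derivatives and strict differentiability *)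

Section Mean_value.
Context {R : realType}.

Lemma mvt_between (G dG : R -> R) (u v : R) :
  (forall s, Num.min u v <= s <= Num.max u v -> is_derive s (1 : R) G (dG s)) ->
  exists2 c, Num.min u v <= c <= Num.max u v & G v - G u = dG c * (v - u).
Proof.
wlog uv : u v / u <= v => [hw|].
  have [uv|vu] := orP (le_total u v); first exact: hw.
  rewrite minC maxC => /(hw _ _ vu)[c cI e]; exists c => //.
  by rewrite -opprB e -mulrN opprB.
rewrite (min_idPl uv) (max_idPr uv) => h.
have [||c cI e] := @MVT_segment R G dG u v uv.
- by move=> s; rewrite in_itv /= => /andP[us sv]; apply: h; rewrite !ltW.
- apply: derivable_within_continuous => s; rewrite in_itv /= => sI.
  by have := h s sI => -[].
by exists c => //; move: cI; rewrite in_itv.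
Qed.

Lemma near_between (a b t0 : R) : a < t0 < b -> \forall s \near t0, a < s < b.
Proof.
move=> t0ab; have /near_in_itvoo : t0 \in `]a, b[ by rewrite in_itv.
by apply: filterS => s; rewrite in_itv.
Qed.

(** A form of Schwarz's theorem for f(s, eps): the derivative [f1] in s exists, and
    its difference quotients in eps converge to [L] as (s, eps) tends to (t0, 0);
    then the derivative [f2] in eps at eps = 0 is differentiable in s at t0, with
    derivative [L]. The mean value theorem in s turns the quotient of [f2] into a
    limit of quotients of [f1]. *)
Lemma slope_exchange (a b t0 : R) (f f1 : R -> R -> R) (f2 : R -> R) (L : R) :
  a < t0 < b ->
  (\forall eps \near (0 : R)^', forall s, a < s < b ->
    is_derive s (1 : R) (fun r => f r eps - f r 0) (f1 s eps - f1 s 0)) ->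
  (fun z : R * R => (f1 z.1 z.2 - f1 z.1 0) / z.2)
    @ filter_prod (nbhs t0) (0 : R)^' --> L ->
  (forall s, a < s < b -> (fun eps => (f s eps - f s 0) / eps) @ (0 : R)^' --> f2 s) ->
  (fun h => (f2 (t0 + h) - f2 t0) / h) @ (0 : R)^' --> L.
Proof.
move=> t0ab hd hL h2; apply/cvgrPdist_le => eta eta0.
have /cvgrPdist_le /(_ _ eta0) [[A B] /= [nA nB] AB] := hL.
have : \forall s \near t0, A s /\ a < s < b by apply: filterI; [|exact: near_between].
move=> /nbhs_ballP[d /= d0 dA].
near=> h.
have h0 : h != 0 by near: h; exact: nbhs_dnbhs_neq.
have hd' : `|h| < d by near: h; apply: dnbhs0_lt.
have between s : Num.min t0 (t0 + h) <= s <= Num.max t0 (t0 + h) -> A s /\ a < s < b.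
  move=> sI; apply: dA; rewrite /ball /= (le_lt_trans _ hd') //.
  have [h'|h'] := leP 0 h.
    have t0h : t0 <= t0 + h by rewrite lerDl.
    move: sI; rewrite (min_idPl t0h) (max_idPr t0h) (ger0_norm h') => /andP[s1 s2].
    by rewrite ler_norml; lra.
  have ht0 : t0 + h <= t0 by rewrite gerDl ltW.
  move: sI; rewrite (min_idPr ht0) (max_idPl ht0) (ltr0_norm h') => /andP[s1 s2].
  by rewrite ler_norml; lra.
have hI : a < t0 + h < b by apply: (between _ _).2; rewrite ge_min le_max !lexx !orbT.
pose Q eps := ((f (t0 + h) eps - f (t0 + h) 0) / eps - (f t0 eps - f t0 0) / eps) / h.
have hQ : (fun eps => `|L - Q eps|) @ (0 : R)^' --> `|L - (f2 (t0 + h) - f2 t0) / h|.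
  apply: cvg_norm; apply: cvgB; first exact: cvg_cst.
  by apply: cvgM; [apply: cvgB; exact: h2|exact: cvg_cst].
rewrite -(cvg_lim _ hQ) //; apply: limr_le; first by apply/cvg_ex; eexists; exact: hQ.
near=> eps.
have Beps : B eps by near: eps.
have deps : forall s, a < s < b ->
    is_derive s (1 : R) (fun r => f r eps - f r 0) (f1 s eps - f1 s 0) by near: eps.
have [s sI|c cI] := mvt_between (G := fun r => f r eps - f r 0)
    (dG := fun s => f1 s eps - f1 s 0) (u := t0) (v := t0 + h).
  by apply: deps; exact: (between s sI).2.
rewrite [t0 + h - t0]addrC addKr => e.
have -> : Q eps = (f1 c eps - f1 c 0) / eps.
  by rewrite /Q -mulrBl e mulrAC mulfK.
exact: (AB (c, eps) (conj (between c cI).1 Beps)).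
Unshelve. all: by end_near. Qed.

Lemma is_derive_line (E W : normedModType R) (f : E -> W) (p d : E) (th : R) :
  differentiable f (p + th *: d) ->
  is_derive th (1 : R) (fun s : R => f (p + s *: d)) ('d f (p + th *: d) d).
Proof.
move=> df.
have dl : is_diff th (fun s : R => p + s *: d) (fun s : R => s *: d).
  by have := is_diffD (is_diff_cst p th) (is_diff_scalel th d); rewrite add0r.
have dl' : differentiable (fun s : R => p + s *: d) th := @ex_diff _ _ _ _ _ _ _ dl.
have dc : differentiable (f \o (fun s : R => p + s *: d)) th.
  exact: differentiable_comp.
apply: DeriveDef; first exact: diff_derivable.
rewrite deriveE // (_ : (fun s : R => f _) = f \o (fun s : R => p + s *: d)) //.
by rewrite diff_comp //= (@diff_val _ _ _ _ _ _ _ dl) /= scale1r.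
Qed.

End Mean_value.

Section Strict_derivative.
Context {R : realType} {E : normedModType R} {Z : Type} (F : set_system Z)
  {FF : Filter F} (e : Z -> R).

(** A function with continuous directional derivatives at [p] is strictly
    differentiable there: the mean value theorem on the segment from y' to y
    gives the difference f(y) - f(y') as a differential taken at a point [xi] of
    the segment, and [xi] tends to [p] with y and y'. The increments lie in the
    span of finitely many vectors [b], so continuity is only needed for each
    direction separately. *)
Lemma slope_C1 (f : E -> R) (p : E) (N : nat) (b : 'I_N -> E) (gamma : 'I_N -> R)
    (y y' : Z -> E) (c : 'I_N -> Z -> R) :
  (\forall z \near p, differentiable f z) ->
  (forall k, {for p, continuous (fun z => 'd f z (b k))}) ->
  y @ F --> p -> y' @ F --> p ->
  (forall z, y z - y' z = \sum_k c k z *: b k) ->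
  (forall k, (fun z => c k z / e z) @ F --> gamma k) ->
  has_slope F e (f \o y) (f \o y') (f p) (\sum_k gamma k * 'd f p (b k)).
Proof.
move=> df cf yp y'p yy' ce.
have fp : {for p, continuous f}.
  by apply: differentiable_continuous; exact: nbhs_singleton df.
split; [exact: continuous_cvg|exact: continuous_cvg|].
move: df => /nbhs_ballP[r /= r0 dfr].
have xi_ex z : exists xi, `|p - xi| <= `|p - y z| + `|p - y' z| /\
    (`|p - y z| + `|p - y' z| < r -> f (y z) - f (y' z) = 'd f xi (y z - y' z)).
  have [near_p|far] := ltP (`|p - y z| + `|p - y' z|) r; last first.
    by exists (y z); split; rewrite ?lerDl // ltNge far.
  pose pt th := y' z + th *: (y z - y' z).
  have ptP th : 0 <= th <= 1 -> `|p - pt th| <= `|p - y z| + `|p - y' z|.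
    move=> /andP[th0 th1].
    have -> : p - pt th = th *: (p - y z) + (1 - th) *: (p - y' z).
      rewrite scalerBl scale1r addrCA -scalerBr opprD addrA -scalerN opprB.
      by congr (_ + _ *: _); rewrite opprB [RHS]addrC addrA subrK.
    rewrite (le_trans (ler_normD _ _)) // !normrZ ger0_norm // ger0_norm ?subr_ge0 //.
    by rewrite lerD // ler_piMl // gerBl.
  have [|th thI] := mvt_between (G := fun th => f (pt th))
      (dG := fun th => 'd f (pt th) (y z - y' z)) (u := 0) (v := 1).
    move=> th; rewrite (min_idPl _) // (max_idPr _) // => thI.
    by apply: is_derive_line; apply: dfr; rewrite -ball_normE /= (le_lt_trans (ptP _ thI)).
  rewrite /pt scale1r scale0r addr0 subrKC subr0 mulr1 => eq1.
  exists (pt th); split=> //; apply: ptP; move: thI.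
  by rewrite (min_idPl _) // (max_idPr _).
have [xi xiP] := choice xi_ex.
have xip : xi @ F --> p.
  apply/cvgrPdist_lt => eta eta0.
  have e2 : 0 < eta / 2 by rewrite divr_gt0.
  near=> z; apply: le_lt_trans (xiP z).1 _.
  rewrite [eta]splitr ltrD //; near: z; exact: cvgr_dist_lt.
have lim : (fun z => \sum_k c k z / e z * 'd f (xi z) (b k)) @ F -->
    \sum_k gamma k * 'd f p (b k).
  apply: cvg_big => [|k _]; first exact: add_continuous.
  by apply: cvgM => //; exact: cvg_comp xip (cf k).
have r2 : 0 < r / 2 by rewrite divr_gt0.
apply: cvg_trans lim; apply: near_eq_cvg; near=> z.
rewrite /= (xiP z).2.
  rewrite yy' raddf_sum mulr_suml; apply: eq_bigr => k _ /=.
  by rewrite linearZ /= mulrAC.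
rewrite [r]splitr ltrD //; near: z; exact: cvgr_dist_lt.
Unshelve. all: by end_near. Qed.

End Strict_derivative.

(** * Slopes in phase space *)

Section Coordinates.
Context {R : realType} {n : nat}.

Lemma coord_linear k : linear (@coord_phase R n k).
Proof. by move=> c u v; rewrite coordD coordZ. Qed.

HB.instance Definition _ k :=
  GRing.isLinear.Build R (phase R n) R^o *:%R (@coord_phase R n k) (coord_linear k).

Lemma coord_phase_continuous k : continuous (@coord_phase R n k).
Proof.
move=> x; rewrite /continuous_at /coord_phase /interleave; case: (odd k).
  apply: (@continuous_comp _ _ _ snd (fun M : 'cV[R]_n => M (half_ord k) 0)).
    exact: cvg_snd.
  exact: coord_continuous.
apply: (@continuous_comp _ _ _ fst (fun M : 'cV[R]_n => M (half_ord k) 0)).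
  exact: cvg_fst.
exact: coord_continuous.
Qed.

Lemma diff_coord (E : normedModType R) (f : E -> phase R n) k z w :
  differentiable f z ->
  differentiable (coord_phase k \o f) z /\
  'd (coord_phase k \o f) z w = coord_phase k ('d f z w).
Proof.
move=> df.
have dk : differentiable (@coord_phase R n k) (f z).
  exact/linear_differentiable/coord_phase_continuous.
split; first exact: differentiable_comp.
by rewrite diff_comp //= diff_lin //; exact: coord_phase_continuous.
Qed.

Lemma is_derive_coord (f : R -> phase R n) t d k :
  is_derive t (1 : R) f d -> is_derive t (1 : R) (coord_phase k \o f) (coord_phase k d).
Proof.
move=> fd; have df : differentiable f t by apply/derivable1_diffP; exact: ex_derive.
have [dkf e] := diff_coord k (1 : R) df.
apply: DeriveDef; first exact: diff_derivable.
by rewrite deriveE // e -deriveE // derive_val.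
Qed.

Lemma cvg_coord (Z : Type) (F : set_system Z) (FF : Filter F) (f : Z -> phase R n) x :
  (forall k, (fun z => coord_phase k (f z)) @ F --> coord_phase k x) -> f @ F --> x.
Proof.
move=> h; rewrite (phase_decomp x).

rewrite (_ : f = fun z => \sum_k coord_phase k (f z) *: phase_basis k).
  apply: cvg_big => [|k _]; first exact: add_continuous.
  by apply: cvgZ; [exact: h|exact: cvg_cst].
by apply/funext => z; rewrite -phase_decomp.
Qed.

Section Coordinate_slopes.
Context {Z : Type} (F : set_system Z) {FF : Filter F} (e : Z -> R).
Variables (f g : Z -> phase R n) (x w : phase R n).

Lemma slope_coord k : phase_slope F e f g x w ->
  has_slope F e (coord_phase k \o f) (coord_phase k \o g) (coord_phase k x) (coord_phase k w).
Proof.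
by move=> [h1 h2]; rewrite /coord_phase /interleave /comp; case: (odd k); [exact: h2|exact: h1].
Qed.

Lemma phase_slope_coord :
  (forall k, has_slope F e (coord_phase k \o f) (coord_phase k \o g)
               (coord_phase k x) (coord_phase k w)) -> phase_slope F e f g x w.
Proof.
move=> h; split=> i.
  by apply: slope_eq (h (ev i)) _ _ _ _ => [z|z||] /=; rewrite coord_ev.
by apply: slope_eq (h (od i)) _ _ _ _ => [z|z||] /=; rewrite coord_od.
Qed.

Lemma phase_slope_cvg : phase_slope F e f g x w -> f @ F --> x /\ g @ F --> x.
Proof.
by move=> h; split; apply: cvg_coord => k; have [] := slope_coord k h.
Qed.

Lemma slope_dilation : phase_slope F e f g x w ->
  phase_slope F e (fun z => dilation (f z)) (fun z => dilation (g z)) (dilation x) (dilation w).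
Proof.
move=> [h1 h2]; split=> //= i.
by apply: slope_eq (slopeN (h2 i)) _ _ _ _ => [z|z||]; rewrite mxE.
Qed.

Lemma slope_fiber_shift : phase_slope F e f g x w ->
  phase_slope F e (fun z => fiber_shift (f z)) (fun z => fiber_shift (g z))
    (fiber_shift x) (fiber_shift w).
Proof.
move=> [h1 h2]; split=> //= i.
by apply: slope_eq (slope_cst _ 0) _ _ _ _ => [z|z||]; rewrite mxE.
Qed.

End Coordinate_slopes.

Lemma phase_slope_comp (Z Z' : Type) (F : set_system Z) (F' : set_system Z')
    (e : Z -> R) (f g : Z -> phase R n) x w (r : Z' -> Z) :
  r @ F' --> F -> phase_slope F e f g x w ->
  phase_slope F' (e \o r) (f \o r) (g \o r) x w.
Proof.
move=> rF [h1 h2]; split=> i.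
  by have [a1 a2 a3] := h1 i; split;
     [exact: cvg_comp rF a1|exact: cvg_comp rF a2|exact: cvg_comp rF a3].
by have [a1 a2 a3] := h2 i; split;
   [exact: cvg_comp rF a1|exact: cvg_comp rF a2|exact: cvg_comp rF a3].
Qed.

Lemma slope_of_is_derive (f : R -> R) t d : is_derive t (1 : R) f d ->
  has_slope (0 : R)^' id (fun h => f (t + h)) (fun=> f t) (f t) d.
Proof.
move=> fd; have q : (fun h => (f (t + h) - f t) / h) @ (0 : R)^' --> d.
  rewrite -(@derive_val _ _ _ _ _ _ _ fd).
  have : derivable f t 1 by [].
  move=> /cvg_ex[l hl]; rewrite /derive (cvg_lim _ hl) //.
  apply: cvg_trans hl; apply: near_eq_cvg; near=> h.
  by rewrite /= [h *: _]mulr1 [h + t]addrC [LHS]mulrC.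
split=> //; last exact: cvg_cst.
have lim : (fun h => f t + h * ((f (t + h) - f t) / h)) @ (0 : R)^' --> f t + 0 * d.
  apply: cvgD; first exact: cvg_cst.
  by apply: cvgM => //; exact: cvg_within.
rewrite mul0r addr0 in lim; apply: cvg_trans lim; apply: near_eq_cvg; near=> h.
have h0 : h != 0 by near: h; exact: nbhs_dnbhs_neq.
by rewrite mulrC divfK // subrKC.
Unshelve. all: by end_near. Qed.

Lemma is_derive_of_slope (f : R -> R) t d :
  has_slope (0 : R)^' id (fun h => f (t + h)) (fun=> f t) (f t) d ->
  is_derive t (1 : R) f d.
Proof.
move=> [_ _ q].
have hl : (fun h : R => h^-1 *: ((f \o shift t) (h *: (1 : R)) - f t)) @ (0 : R)^' --> d.
  apply: cvg_trans q; apply: near_eq_cvg; near=> h.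
  by rewrite /= [h *: _]mulr1 [h + t]addrC [RHS]mulrC.
apply: DeriveDef; first by apply/cvg_ex; exists d.
exact: cvg_lim hl.
Unshelve. all: by end_near. Qed.

(** The curve is the line x + eps v, with its first component normalized and the
    second projected orthogonally to it. Since q.a = 0 the norm of q + eps a is
    stationary at eps = 0, and tangency of [v] makes the derivative of the
    projection vanish as well. *)
Lemma tangent_curve (x v : phase R n) : cotangent_sphere x -> tangent x v ->
  exists c : R -> phase R n, [/\ c 0 = x, forall eps, cotangent_sphere (c eps) &
    phase_slope (0 : R)^' id c (fun=> x) x v].
Proof.
move=> /cotangent_sphereE[qq qp] [qa qb].
set q := x.1 in qq qp qa qb *; set p := x.2 in qp qb *.
set a := v.1 in qa qb *; set b := v.2 in qb *.
pose line (u w : 'cV[R]_n) (eps : R) : 'cV[R]_n := u + eps *: w.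
have slope_id : has_slope (0 : R)^' id id (fun=> 0) 0 1.
  split; [exact: cvg_within|exact: cvg_cst|].
  apply: cvg_near_cst; near=> h.
  by rewrite /= subr0 mulfV //; near: h; exact: nbhs_dnbhs_neq.
have slope_line u w : vec_slope (0 : R)^' id (line u w) (fun=> u) u w.
  move=> i; apply: slope_eq (slopeD (slope_cst _ (u i 0))
    (slopeM slope_id (slope_cst _ (w i 0)))) _ _ _ _ => [z|z||].
  - by rewrite !mxE.
  - by rewrite mul0r addr0.
  - by rewrite mul0r addr0.
  - by rewrite mul1r mul0r add0r addr0.
pose N2 eps := dot (line q a eps) (line q a eps).
have N2E eps : N2 eps = 1 + eps ^+ 2 * dot a a.
  by rewrite /N2 /line !dotDl !dotDr !dotZl !dotZr qq qa (dotC a) qa; ring.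
have N2_gt0 eps : 0 < N2 eps.
  rewrite N2E ltr_pwDl // mulr_ge0 ?sqr_ge0 //.
  by apply: sumr_ge0 => i _; rewrite -expr2 sqr_ge0.
pose r eps := (Num.sqrt (N2 eps))^-1.
pose Q eps := r eps *: line q a eps.
pose P eps := line p b eps - dot (line p b eps) (Q eps) *: Q eps.
have slope_N2 : has_slope (0 : R)^' id N2 (fun=> 1) 1 0.
  apply: slope_eq (slope_dot (slope_line q a) (slope_line q a)) _ _ _ _ => //.
  by rewrite dotC qa addr0.
have slope_r : has_slope (0 : R)^' id r (fun=> 1) 1 0.
  apply: slope_eq (slopeV _ (slope_sqrt ltr01 slope_N2)) _ _ _ _ => [|z|z||] //;
    rewrite ?sqrtr1 ?invr1 ?oner_neq0 //; ring.
have slope_Q : vec_slope (0 : R)^' id Q (fun=> q) q a.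
  move=> i; apply: slope_eq (vec_slopeZ slope_r (slope_line q a) i) _ _ _ _ => //.
  - by move=> z; rewrite scale1r.
  - by rewrite scale1r.
  - by rewrite scale0r scale1r add0r.
have slope_P : vec_slope (0 : R)^' id P (fun=> p) p b.
  move=> i; apply: slope_eq (vec_slopeB (slope_line p b)
    (vec_slopeZ (slope_dot (slope_line p b) slope_Q) slope_Q) i) _ _ _ _ => //.
  - by move=> z; rewrite (dotC p q) qp scale0r subr0.
  - by rewrite (dotC p q) qp scale0r subr0.
  - by rewrite (dotC p q) qp (dotC b) (dotC p) [dot q b + _]addrC qb !scale0r addr0 subr0.
have QQ eps : dot (Q eps) (Q eps) = 1.
  rewrite dotZl dotZr -/(N2 eps) mulrA -expr2 /r exprVn sqr_sqrtr ?ltW //.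
  by rewrite mulVf // gt_eqF.
exists (fun eps => (Q eps, P eps)); split.
- have r0 : r 0 = 1 by rewrite /r N2E expr0n mul0r addr0 sqrtr1 invr1.
  have Q0 : Q 0 = q by rewrite /Q r0 /line scale0r addr0 scale1r.
  rewrite /P Q0 /line scale0r addr0 dotC qp scale0r subr0.
  by rewrite /q /p; case: (x).
- move=> eps; apply/cotangent_sphereE; split=> //=.
  by rewrite /P dotBr dotZr QQ mulr1 dotC subrr.
- by split.
Unshelve. all: by end_near. Qed.

End Coordinates.

Lemma pair0_sum (R : realType) (n N : nat) (c : 'I_N -> R) (f : 'I_N -> phase R n) :
  (0 : R, \sum_l c l *: f l) = \sum_l c l *: (0 : R, f l).
Proof.
elim/big_rec2: _ => // l u w _ <-.
by congr pair; rewrite /= scaler0 addr0.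
Qed.

(** * The flow and its tangent map *)

Section Flow.
Context {R : realType} {m : nat}.
Variables (X : phase R m.+1 -> phase R m.+1) (a b : R) (U : set (phase R m.+1)).
Variable Phi : R * phase R m.+1 -> phase R m.+1.
Hypothesis flow : local_flow X a b U Phi.

Definition tangent_flow (x v : phase R m.+1) (t : R) : phase R m.+1 := 'd Phi (t, x) (0, v).

(** The flow is strictly differentiable; letting [s] vary makes the derivative in
    the initial condition uniform in time near [t]. *)
Lemma slope_flow (Z : Type) (F : set_system Z) (FF : Filter F) (e s : Z -> R)
    (y y' : Z -> phase R m.+1) (t : R) (x v : phase R m.+1) :
  a < t < b -> U x -> s @ F --> t -> phase_slope F e y y' x v ->
  phase_slope F e (fun z => Phi (s z, y z)) (fun z => Phi (s z, y' z))
    (Phi (t, x)) (tangent_flow x v t).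
Proof.
case: flow => -[_ oU] PhiC1 _ _ _ tab Ux st yy'.
have [yx y'x] := phase_slope_cvg yy'.
have dPhi : \forall z \near (t, x), differentiable Phi z.
  exists ([set s | a < s < b], U) => /=.
    by split; [exact: near_between|exact: open_nbhs_nbhs].
  by move=> [t' x'] /= [t'ab Ux']; exact: (PhiC1 _ _ t'ab Ux').1.
apply: phase_slope_coord => k.
pose B l : R * phase R m.+1 := (0, phase_basis l).
have dE w : \forall z \near (t, x), 'd (coord_phase k \o Phi) z w = coord_phase k ('d Phi z w).
  by apply: filterS dPhi => z dz; exact: (diff_coord k w dz).2.
have -> : coord_phase k (tangent_flow x v t) =
    \sum_l coord_phase l v * 'd (coord_phase k \o Phi) (t, x) (B l).
  have -> : tangent_flow x v t = \sum_l coord_phase l v *: 'd Phi (t, x) (B l).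
    rewrite /tangent_flow {1}(phase_decomp v) pair0_sum linear_sum.
    by apply: eq_bigr => l _; exact: linearZ.
  rewrite coord_sum; apply: eq_bigr => l _.
  by rewrite coordZ (nbhs_singleton (dE (B l))).
apply: (slope_C1 (f := coord_phase k \o Phi) (p := (t, x)) (b := B)
    (y := fun z => (s z, y z)) (y' := fun z => (s z, y' z))
    (c := fun l z => coord_phase l (y z) - coord_phase l (y' z))).
- by apply: filterS dPhi => z dz; exact: (diff_coord k 0 dz).1.
- move=> l; have lim : (fun z => coord_phase k ('d Phi z (B l))) @ (t, x) -->
      'd (coord_phase k \o Phi) (t, x) (B l).
    rewrite (nbhs_singleton (dE (B l))).
    apply: (@continuous_comp _ _ _ (fun z => 'd Phi z (B l)) (@coord_phase R m.+1 k)).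
      exact: (PhiC1 _ _ tab Ux).2.
    exact: coord_phase_continuous.
  apply: cvg_trans lim; apply: near_eq_cvg.
  by apply: filterS (dE (B l)) => z ->.
- exact: cvg_pair st yx.
- exact: cvg_pair st y'x.
- move=> z; rewrite -[LHS]/(s z - s z, y z - y' z) subrr {1}(phase_decomp (y z - y' z)).
  by rewrite pair0_sum; apply: eq_bigr => l _; rewrite coordD coordN.
- by move=> l; have [] := slope_coord l yy'.
Qed.

Lemma slope_along_flow t x : a < t < b -> U x -> cotangent_sphere x ->
  phase_slope (0 : R)^' id (fun h => Phi (t + h, x)) (fun=> Phi (t, x)) (Phi (t, x))
    (X (Phi (t, x))).
Proof.
case: flow => _ _ _ _ dPhi tab Ux xS; apply: phase_slope_coord => k.
exact: slope_of_is_derive (is_derive_coord k (dPhi _ _ tab Ux xS)).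
Qed.

(** The flow at time 0 is the identity on T^*S^(n-1) only, whence the need to
    differentiate along a curve that stays there. *)
Lemma tangent_flow0 x v : U x -> cotangent_sphere x -> tangent x v -> tangent_flow x v 0 = v.
Proof.
move=> Ux xS xv; have [c [c0 cS dc]] := tangent_curve xS xv.
have [[ab oU] _ Phi0 _ _] := flow.
have [cx _] := phase_slope_cvg dc.
have Uc : \forall h \near (0 : R)^', U (c h) by apply: cx; exact: open_nbhs_nbhs.
have FF : Filter (0 : R)^' by exact: _.
have sPhi := slope_flow FF ab Ux (@cvg_cst R 0 _ _ FF) dc.
apply: coord_inj => k; have [_ _ d1] := slope_coord k sPhi; have [_ _ d2] := slope_coord k dc.
apply: (@cvg_unique _ (@norm_hausdorff _ R^o) _ _ _ _ d1).
apply: cvg_trans d2; apply: near_eq_cvg; near=> h.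
by rewrite /= !Phi0 //; near: h; exact: Uc.
Unshelve. all: by end_near. Qed.

(** The constraints are constant along the image of a curve on T^*S^(n-1). *)
Lemma tangent_flow_tangent t x v : a < t < b -> U x -> cotangent_sphere x -> tangent x v ->
  tangent (Phi (t, x)) (tangent_flow x v t).
Proof.
move=> tab Ux xS xv; have [c [c0 cS dc]] := tangent_curve xS xv.
have [[_ oU] _ _ PhiS _] := flow.
have [cx _] := phase_slope_cvg dc.
have Uc : \forall h \near (0 : R)^', U (c h) by apply: cx; exact: open_nbhs_nbhs.
have FF : Filter (0 : R)^' by exact: _.
have [s1 s2] := slope_flow FF tab Ux (@cvg_cst R t _ _ FF) dc.
have slope0 (f g : R -> R) l d : has_slope (0 : R)^' id f g l d ->
    (forall h, U (c h) -> f h = g h) -> d = 0.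
  move=> [_ _ fd] fg; apply: (@cvg_unique _ (@norm_hausdorff _ R^o) _ _ _ _ fd).
  apply: cvg_near_cst; near=> h; rewrite fg ?subrr ?mul0r //; near: h; exact: Uc.
split.
  have : dot (tangent_flow x v t).1 (Phi (t, x)).1 +
      dot (Phi (t, x)).1 (tangent_flow x v t).1 = 0.
    apply: slope0 (slope_dot s1 s1) _ => h Uh.
    by rewrite ((cotangent_sphereE _).1 (PhiS _ _ tab Uh (cS h))).1
      ((cotangent_sphereE _).1 (PhiS _ _ tab Ux xS)).1.
  by rewrite dotC -mulr2n => /eqP; rewrite mulrn_eq0 /= => /eqP.
apply: slope0 (slope_dot s1 s2) _ => h Uh.
by rewrite ((cotangent_sphereE _).1 (PhiS _ _ tab Uh (cS h))).2
  ((cotangent_sphereE _).1 (PhiS _ _ tab Ux xS)).2.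
Unshelve. all: by end_near. Qed.

End Flow.

(** * Invariance of the measure *)

Section Veselova_flow.
Context {R : realType} {m : nat}.
Variable J : 'rV[R]_m.+1.
Hypothesis J_gt0 : forall i, 0 < J 0 i.
Variables (a b : R) (U : set (phase R m.+1)) (Phi : R * phase R m.+1 -> phase R m.+1).
Hypothesis flow : local_flow (veselova_field J) a b U Phi.

(** The linearized equation w' = dX w: [slope_exchange] applied, coordinate by
    coordinate, to the flow of the points of a curve with tangent vector [v]. *)
Lemma slope_tangent_flow t x v : a < t < b -> U x -> cotangent_sphere x -> tangent x v ->
  phase_slope (0 : R)^' id (fun h => tangent_flow Phi x v (t + h))
    (fun=> tangent_flow Phi x v t) (tangent_flow Phi x v t)
    (d_field J (Phi (t, x)) (tangent_flow Phi x v t)).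
Proof.
move=> tab Ux xS xv; have [c [c0 cS dc]] := tangent_curve xS xv.
have [[_ oU] PhiC1 _ PhiS PhiX] := flow.
have [cx _] := phase_slope_cvg dc.
have Uc : \forall h \near (0 : R)^', U (c h) by apply: cx; exact: open_nbhs_nbhs.
have FF : Filter (0 : R)^' by exact: _.
have q0 : (Phi (t, x)).1 != 0 by apply: base_neq0; exact: PhiS.
have th : (fun h => t + h) @ (0 : R)^' --> t.
  rewrite -[X in _ --> X]addr0; apply: cvgD; [exact: cvg_cst|exact: cvg_within].
apply: phase_slope_coord => k; split.
- have lim : (fun h => tangent_flow Phi x v (t + h)) @ (0 : R)^' --> tangent_flow Phi x v t.
    apply: (@cvg_comp _ _ _ (fun h => (t + h, x)) (fun z => 'd Phi z (0, v)) _ (nbhs (t, x))).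
      exact: cvg_pair th (@cvg_cst _ x _ _ FF).
    exact: (PhiC1 _ _ tab Ux).2.
  exact: cvg_comp lim (@coord_phase_continuous R m.+1 k _).
- exact: cvg_cst.
apply: (@slope_exchange R a b t (fun s eps => coord_phase k (Phi (s, c eps)))
  (fun s eps => coord_phase k (veselova_field J (Phi (s, c eps))))
  (fun s => coord_phase k (tangent_flow Phi x v s))) => //.
- near=> eps => s sab; rewrite c0.
  have Ueps : U (c eps) by near: eps; exact: Uc.
  have := is_deriveB (is_derive_coord k (PhiX _ _ sab Ueps (cS eps)))
            (is_derive_coord k (PhiX _ _ sab Ux xS)).
  by [].
- rewrite c0.
  have FP : Filter (filter_prod (nbhs t) (0 : R)^') by exact: _.
  have FN : Filter (nbhs t) by exact: _.
  have dc2 := phase_slope_comp (@cvg_snd _ _ (nbhs t) (0 : R)^' FN) dc.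
  have sPhi := slope_flow flow FP tab Ux (@cvg_fst _ _ (nbhs t) (0 : R)^' FF) dc2.
  by have [_ _] := slope_coord k (slope_field J_gt0 q0 sPhi).
- move=> s sab; rewrite c0.
  have sPhi := slope_flow flow FF sab Ux (@cvg_cst R s _ _ FF) dc.
  by have [_ _] := slope_coord k sPhi.
Unshelve. all: by end_near. Qed.

Lemma density_frame_det_constant x (v : 'I_(m.*2) -> phase R m.+1) t :
  U x -> cotangent_sphere x -> (forall i, tangent x (v i)) -> a < t < b ->
  veselova_density J (Phi (t, x)) *
    frame_det (Phi (t, x)) (fun i => tangent_flow Phi x (v i) t) =
  veselova_density J x * frame_det x v.
Proof.
move=> Ux xS xv tab; have [[ab _] _ Phi0 PhiS _] := flow.
pose G s := veselova_density J (Phi (s, x))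
  * frame_det (Phi (s, x)) (fun i => tangent_flow Phi x (v i) s).
have G0 : G 0 = veselova_density J x * frame_det x v.
  rewrite /G Phi0 //; congr (_ * frame_det _ _); apply/funext => i.
  exact: (tangent_flow0 flow).
rewrite -G0 -/(G t).
have dG s : a < s < b -> is_derive s (1 : R) G 0.
  move=> sab; have yS := PhiS _ _ sab Ux xS.
  have sy := slope_along_flow flow sab Ux xS.
  have sW i := slope_tangent_flow sab Ux xS (xv i).
  have W_tan i := tangent_flow_tangent flow sab Ux xS (xv i).
  apply: is_derive_of_slope.
  have sdet : has_slope (0 : R)^' id
      (fun h => frame_det (Phi (s + h, x)) (fun i => tangent_flow Phi x (v i) (s + h)))
      (fun=> frame_det (Phi (s, x)) (fun i => tangent_flow Phi x (v i) s))
      (frame_det (Phi (s, x)) (fun i => tangent_flow Phi x (v i) s))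
      (divergence J (Phi (s, x)) *
        frame_det (Phi (s, x)) (fun i => tangent_flow Phi x (v i) s)).
    rewrite -(sum_det_set_row_field J_gt0 yS W_tan).
    apply: slope_det => k c; elim/frame_ind: k => [||k].
    - apply: slope_eq (slope_coord c (slope_dilation sy)) _ _ _ _ => [h|h||];
        by rewrite mxE frame_ev0.
    - apply: slope_eq (slope_coord c (slope_fiber_shift sy)) _ _ _ _ => [h|h||];
        by rewrite mxE frame_od0.
    - apply: slope_eq (slope_coord c (sW k)) _ _ _ _ => [h|h||];
        by rewrite mxE frame_lift.
  apply: slope_eq (slopeM (slope_density J_gt0 yS sy) sdet) _ _ _ _ => //.
  by rewrite mulNr mulNr mulrCA mulrA addNr.
have [s sI|s sI] := mvt_between (G := G) (dG := fun=> 0) (u := 0) (v := t).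
  apply: dG; have [/andP[a0 b0] /andP[a1 b1]] := (ab, tab).
  case/andP: sI => s1 s2; apply/andP; split.
    by apply: lt_le_trans s1; rewrite lt_min a0 a1.
  by apply: le_lt_trans s2 _; rewrite gt_max b0 b1.
by rewrite mul0r => /eqP; rewrite subr_eq0 => /eqP.
Qed.

End Veselova_flow.

Theorem proposition3p7 (R : realType) (n : nat) (hn : (2 <= n)%N)
    (J : 'rV[R]_n) (hJ : forall i, 0 < J 0 i) :
  (forall x, cotangent_sphere x -> tangent x (veselova_field J x)) /\
  invariant_measure (veselova_field J) (veselova_density J).
Proof.
split=> [x|]; first exact: veselova_tangent.
split=> [x|a b U Phi flow t x v tab Ux xS xv]; first exact: veselova_density_gt0.
case: n hn J hJ U Phi flow x v Ux xS xv => // m _ J hJ U Phi flow x v Ux xS xv.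
have [[_ _] PhiC1 _ PhiS _] := flow.
have -> : (fun i => 'd (fun y => Phi (t, y)) x (v i)) = (fun i => tangent_flow Phi x (v i) t).
  apply/funext => i.
  have dpair : is_diff x (fun y : phase R m.+1 => (t, y)) (fun y => (0, y)).
    exact: is_diff_pair (is_diff_cst t x) (is_diff_id x).
  rewrite (_ : (fun y => Phi (t, y)) = Phi \o (fun y => (t, y))) //.
  rewrite diff_comp; last exact: (PhiC1 _ _ tab Ux).1.
    by rewrite /= (@diff_val _ _ _ _ _ _ _ dpair).
  exact: (@ex_diff _ _ _ _ _ _ _ dpair).
have [K liouvilleE] := @liouville_form_det R m.
rewrite !liouvilleE //; first by rewrite !(mulrCA _ K) (density_frame_det_constant hJ flow).
  exact: PhiS.
by move=> i; apply: (tangent_flow_tangent flow).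
Qed.
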